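(* Let $I=\langle f_1,\dots,f_N\rangle\subset R=\mathbb{C}[x_1,\dots,x_n]$ be an ideal such that $\boldsymbol{0}\in\mathbb{C}^n$ is an isolated solution of $f_1=\dots=f_N=0$. Let $\ge$ be an order on $\mathbb{Z}_{\ge0}^n$ that defines a local monomial order, and let $\succeq$ be the opposite order. Then the number of elements in the initial support $\operatorname{in}_\succeq(D_{\boldsymbol{0}}[I])$ equals the dimension of the dual space $D_{\boldsymbol{0}}[I]$, and therefore is the multiplicity of $\boldsymbol{0}$ as a solution of the system. Moreover, the set of standard monomials with respect to the local order $\ge$ is $\{\boldsymbol{x}^\alpha\mid\alpha\in\operatorname{in}_\succeq(D_{\boldsymbol{0}}[I])\}$.
   Context: A local monomial order is a total order $\ge$ on monomials (equivalently on exponents $\mathbb{Z}_{\ge0}^n$), compatible with multiplication, in which $1>x_i$ for all $i$. The opposite order $\succeq$ is defined by $\alpha\succeq\beta\Leftrightarrow\alpha\le\beta$; it is a global monomial order. For nonzero $f\in R$, $\operatorname{in}_\ge(f)$ is the largest monomial of $f$ with respect to $\ge$; $\operatorname{in}_\ge(I)=\{\operatorname{in}_\ge(f)\mid f\in I,\ f\neq 0\}$ (generating the initial ideal). The standard monomials with respect to $\ge$ are the monomials not contained in the initial ideal $\operatorname{in}_\ge(I)$. Differential functionals: for $\alpha\in\mathbb{Z}_{\ge0}^n$, $\Delta_\alpha(f)=\frac{1}{\alpha_1!\cdots\alpha_n!}\frac{\partial^{|\alpha|}f}{\partial x_1^{\alpha_1}\cdots\partial x_n^{\alpha_n}}\Big|_{\boldsymbol{x}=\boldsymbol{0}}$.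 The local dual space is $D_{\boldsymbol{0}}[I]=\{L\in\operatorname{Span}_{\mathbb{C}}\{\Delta_\alpha\mid\alpha\in\mathbb{Z}_{\ge0}^n\}\mid L(f)=0\text{ for all }f\in I\}$. For $L=\sum c_\alpha\Delta_\alpha\ne0$, $\operatorname{supp}(L)=\{\alpha\mid c_\alpha\ne0\}$ and $\operatorname{in}_\succeq(L)$ is the maximal element of $\operatorname{supp}(L)$ with respect to $\succeq$. The initial support of the dual space is $\operatorname{in}_\succeq(D_{\boldsymbol{0}}[I])=\{\operatorname{in}_\succeq(L)\mid L\in D_{\boldsymbol{0}}[I],\ L\ne0\}$. The multiplicity of $\boldsymbol{0}$ is the $\mathbb{C}$-dimension of $R_{\boldsymbol{0}}/IR_{\boldsymbol{0}}$, where $R_{\boldsymbol{0}}$ is the localization of $R$ at the maximal ideal of the origin. *)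

(* Defs.v *)
From HB Require Import structures.
From mathcomp Require Import all_boot all_order all_algebra.
From mathcomp Require Import complex finmap mpoly.
From mathcomp Require Import boolp classical_sets functions cardinality reals.
From mathcomp Require Import topology normedtype.
Import numFieldNormedType.Exports.

Set Implicit Arguments.
Unset Strict Implicit.
Unset Printing Implicit Defensive.

Import Order.TTheory GRing.Theory Num.Theory.
Local Open Scope classical_set_scope.
Local Open Scope ring_scope.

(* For a subring B of A and S `<=` B, the ideal of B generated by S.
   B = setT gives the ideals of A itself. *)
Definition ideal_in (A : comNzRingType) (B S : set A) : set A :=
  [set x | exists m (c s : 'I_m -> A),
     [/\ forall i, B (c i), forall i, S (s i) & x = \sum_(i < m) c i * s i]].

Definition ideal_gen (A : comNzRingType) (S : set A) : set A :=
  ideal_in setT S.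

(* The quotient of the subspace W by the subspace U `<=` W has dimension d:
   the classes modulo U of some b_0, ..., b_(d-1) in W form a basis of it. *)
Definition quot_dim (K : fieldType) (V : lmodType K) (W U : set V) (d : nat) :=
  exists b : 'I_d -> V,
    [/\ forall i, W (b i),
        forall w, W w -> exists c : 'I_d -> K, U (w - \sum_(i < d) c i *: b i)
      & forall c : 'I_d -> K, U (\sum_(i < d) c i *: b i) -> forall i, c i = 0].

Definition has_dim (K : fieldType) (V : lmodType K) (W : set V) (d : nat) :=
  quot_dim W [set 0] d.

Definition ratfun (K : fieldType) (n : nat) : Type := {fraction {mpoly K[n]}}.

Section RatfunLmodule.
Variables (K : fieldType) (n : nat).

HB.instance Definition _ := GRing.Field.on (ratfun K n).

Definition ratfun_of (p : {mpoly K[n]}) : ratfun K n := tofrac p.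

Definition ratfun_scale (c : K) (x : ratfun K n) : ratfun K n :=
  ratfun_of c%:MP * x.

Fact ratfun_scaleA a b x :
  ratfun_scale a (ratfun_scale b x) = ratfun_scale (a * b) x.
Proof. by rewrite /ratfun_scale /ratfun_of mulrA -rmorphM -mpolyCM. Qed.

Fact ratfun_scale1 : left_id 1 ratfun_scale.
Proof. by move=> x; rewrite /ratfun_scale /ratfun_of mpolyC1 rmorph1 mul1r. Qed.

Fact ratfun_scaleDr : right_distributive ratfun_scale +%R.
Proof. by move=> a x y; rewrite /ratfun_scale mulrDr. Qed.

Fact ratfun_scaleDl x : {morph ratfun_scale^~ x : a b / a + b}.
Proof.
by move=> a b; rewrite /ratfun_scale /ratfun_of mpolyCD rmorphD mulrDl.
Qed.

HB.instance Definition _ := GRing.Zmodule_isLmodule.Build K (ratfun K n)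
  ratfun_scaleA ratfun_scale1 ratfun_scaleDr ratfun_scaleDl.

End RatfunLmodule.

Section Defs.
Variables (K : numFieldType) (n : nat).
Implicit Types (ge : rel 'X_{1..n}) (I : set {mpoly K[n]}).

Definition zero_set (N : nat) (f : 'I_N -> {mpoly K[n]}) : set 'rV[K]_n :=
  [set x | forall i, (f i).@[x 0] = 0].

(* The localization R_0 at the origin of the domain R = K[x_1, ..., x_n],
   as a subring of the fraction field of R. *)
Definition local_ring : set (ratfun K n) :=
  [set x | exists p q : {mpoly K[n]},
     q.@[fun=> 0] != 0 /\ x = ratfun_of p / ratfun_of q].

Definition local_ideal I : set (ratfun K n) :=
  ideal_in local_ring (@ratfun_of K n @` I).

Definition multiplicity_at0 I (d : nat) : Prop :=
  quot_dim local_ring (local_ideal I) d.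

(* [ge a b] reads: x^a >= x^b. *)
Record local_monomial_order ge : Prop := LocalMonomialOrder {
  lmo_refl : reflexive ge;
  lmo_anti : antisymmetric ge;
  lmo_trans : transitive ge;
  lmo_total : total ge;
  lmo_add : forall a b c : 'X_{1..n}, ge a b -> ge (a + c)%MM (b + c)%MM;
  lmo_local : forall i : 'I_n, ge 0%MM U_(i)%MM && ~~ ge U_(i)%MM 0%MM
}.

Definition opposite_order ge : rel 'X_{1..n} := fun a b => ge b a.

Definition is_largest ge (s : seq 'X_{1..n}) (a : 'X_{1..n}) : Prop :=
  a \in s /\ forall b, b \in s -> ge a b.

Definition initial_monomials ge I : set {mpoly K[n]} :=
  [set 'X_[a] | a in
     [set a | exists p, [/\ I p, p != 0 & is_largest ge (msupp p) a]]].

Definition initial_ideal ge I : set {mpoly K[n]} :=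
  ideal_gen (initial_monomials ge I).

Definition standard_monomials ge I : set {mpoly K[n]} :=
  [set m | (exists a : 'X_{1..n}, m = 'X_[a]) /\ ~ initial_ideal ge I m].

Definition Delta (a : 'X_{1..n}) (p : {mpoly K[n]}) : K :=
  (\prod_(i < n) (a i)`!)%N%:R^-1 * (p^`M[a]).@[fun=> 0].

(* Functionals are valued in K^o so that they form a K-vector space. *)
Definition Delta_comb (c : {fsfun 'X_{1..n} -> K with 0}) :
    {mpoly K[n]} -> K^o :=
  fun p => \sum_(a <- finsupp c) c a * Delta a p.

Definition dual_space I : set ({mpoly K[n]} -> K^o) :=
  [set L | (exists c, L = Delta_comb c) /\ forall p, I p -> L p = 0].

(* The Delta_a are linearly independent, so that c is determined by the
   functional L = Delta_comb c, and finsupp c is supp(L). *)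
Definition initial_support ge I : set 'X_{1..n} :=
  [set a | exists c, [/\ dual_space I (Delta_comb c), Delta_comb c <> 0
                       & is_largest ge (finsupp c) a]].

End Defs.

(* Main.v *)
(* The heart of the matter is that an isolated zero has finite multiplicity: for each
   variable x_i some u x_i^k lies in I with u(0) <> 0.  Otherwise Zorn's lemma gives a prime
   ideal P containing I and avoiding all the products u x_i^k, so P is contained in the
   maximal ideal of the origin and x_i is not in P.  Noether normalization makes R/P integral
   over a polynomial ring B = K[y_1, ..., y_d], and a linear form theta is chosen to separate
   the origin from the other points over y = 0.  By Gauss's lemma over B, the relations of
   theta form a principal ideal (H) with H monic; H(0, 0) = 0, so H(y, T) has a small root
   for each small y, and lying over extends (y, root) to a point of the zero set of P, close
   to the origin and with x_i <> 0 for a generic y.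

   Once all monomials of high degree lie in J, the contraction to R of the localization of I,
   each monomial x^b has a unique normal form modulo J supported on the exponents of standard
   monomials a with x^b >= x^a.  The coefficient of x^a in the normal form is a functional
   killing I whose initial exponent is a, and conversely a functional with an initial exponent
   in the initial ideal does not kill I. *)
Require Import Defs.
From HB Require Import structures.
From mathcomp Require Import all_boot all_order all_algebra.
From mathcomp Require Import complex finmap mpoly.
From mathcomp Require Import boolp classical_sets functions cardinality reals.
From mathcomp Require Import topology normedtype.
Import numFieldNormedType.Exports.
Import Order.TTheory GRing.Theory Num.Theory.
Set Implicit Arguments.
Unset Strict Implicit.
Unset Printing Implicit Defensive.
Local Open Scope classical_set_scope.
Local Open Scope ring_scope.

(** * Polynomial functions *)

Lemma mnm_neq0_gt0 (n : nat) (m : 'X_{1..n}) : m != 0%MM -> exists i, (0 < m i)%N.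
Proof.
move=> m0; apply/existsP; apply: contraNT m0; rewrite negb_exists => /forallP h.
by apply/eqP/mnmP => i; move: (h i); rewrite mnm0E lt0n negbK => /eqP.
Qed.

Lemma mpoly0_const (A : nzRingType) (p : {mpoly A[0]}) : p = (p@_0%MM)%:MP.
Proof.
by apply/mpolyP => a; rewrite mcoeffC (_ : a = 0%MM) ?eqxx ?mulr1//; apply/mnmP; case.
Qed.

Lemma mpoly_rmorph_ext (n : nat) (A S : comNzRingType)
    (f g : {rmorphism {mpoly A[n]} -> S}) :
  (forall c, f c%:MP = g c%:MP) -> (forall i, f 'X_i = g 'X_i) -> f =1 g.
Proof.
move=> fgC fgX p; rewrite (mpolyE p) !rmorph_sum; apply: eq_bigr => m _.
rewrite -mul_mpolyC !rmorphM fgC mpolyXE_id !rmorph_prod; congr (_ * _).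
by apply: eq_bigr => i _; rewrite !rmorphXn /= fgX.
Qed.

(** The [size q] candidates [e / (k + 2)] are distinct and lie strictly between 0 and [e], while a
    nonzero [q] has fewer than [size q] roots. *)
Lemma exists_small_nonroot (K : numFieldType) (q : {poly K}) (e : K) :
  q != 0 -> 0 < e -> exists s, [/\ 0 < s, s < e & q.[s] != 0].
Proof.
move=> q0 e0; pose r := [seq e / (k.+2)%:R | k <- iota 0 (size q)].
have ur : uniq r.
  rewrite map_inj_uniq ?iota_uniq// => i j /(mulfI (lt0r_neq0 e0)) /invr_inj.
  by move/eqP; rewrite eqr_nat => /eqP[].
have [/(max_poly_roots q0)/(_ ur)|] := boolP (all (root q) r).
  by rewrite size_map size_iota ltnn.
case/allPn => s /mapP[k _ ->] ns; exists (e / k.+2%:R); split => //.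
  by rewrite divr_gt0 ?ltr0n.
by rewrite ltr_pdivrMr ?ltr0n// ltr_pMr// ltr1n.
Qed.

Lemma coef_muni (n : nat) (A : nzRingType) (p : {mpoly A[n.+1]}) (m : 'X_{1..n.+1}) :
  (muni p)`_(m ord_max) @_[multinom m (widen_ord (leqnSn n) i) | i < n] = p@_m.
Proof.
rewrite muniE coef_sum raddf_sum /= {3}(mpolyE p) raddf_sum /=.
apply: eq_bigr => a _; rewrite coefZ coefXn mcoeffZ mcoeffX.
case: (eqVneq a m) => [->|am]; first by rewrite eqxx mulr1 mcoeffZ mcoeffX eqxx.
case: eqP => [e|_]; last by rewrite mulr0 mcoeff0 mulr0.
rewrite mulr1 mcoeffZ mcoeffX; case: eqP => [/mnmP E|//].
case/eqP: am; apply/mnmP => i; case: (unliftP ord_max i) => [j|] -> //.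
have := E j; rewrite !mnmE (_ : widen_ord _ j = lift ord_max j) //.
by apply: val_inj; rewrite /= /bump leqNgt ltn_ord.
Qed.

Definition extend_last (n : nat) (S : Type) (v : 'I_n -> S) (s : S) (i : 'I_n.+1) : S :=
  oapp v s (insub (i : nat)).

Lemma extend_last_max (n : nat) (S : Type) (v : 'I_n -> S) s :
  extend_last v s ord_max = s.
Proof. by rewrite /extend_last insubF ?ltnn. Qed.

Lemma extend_last_widen (n : nat) (S : Type) (v : 'I_n -> S) s i :
  extend_last v s (widen_ord (leqnSn n) i) = v i.
Proof. by rewrite /extend_last insubT //= => lt; congr v; apply: val_inj. Qed.

Lemma mmap_muni (n : nat) (A S : comNzRingType) (f : {rmorphism A -> S})
    (h : 'I_n.+1 -> S) (p : {mpoly A[n.+1]}) :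
  mmap f h p = (map_poly (mmap f (fun i => h (widen_ord (leqnSn n) i))) (muni p)).[h ord_max].
Proof.
rewrite muniE rmorph_sum horner_sum; apply: eq_bigr => a _ /=.
rewrite !map_polyZ /= map_polyXn !hornerZ hornerXn mmapZ mmapX -mulrA.
rewrite /mmap1 big_ord_recr /=; congr (_ * (_ * _)).
by apply: eq_bigr => i _; rewrite mnmE.
Qed.

(** Induction on [n]: the coefficient, with respect to the last variable, that carries the leading
    monomial is nonzero. A point of the other coordinates keeps it nonzero, and a nonroot completes
    the point. *)
Lemma mpoly_nonvanishing (K : numFieldType) (n : nat) (p : {mpoly K[n]}) :
  p != 0 -> exists v, p.@[v] != 0.
Proof.
elim: n p => [|n IHn] p p0.
  by exists (fun=> 0); move: p0; rewrite [p]mpoly0_const mevalC mpolyC_eq0.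
pose m := mlead p; set c := (muni p)`_(m ord_max).
have /IHn[v cv] : c != 0.
  apply/eqP => c0; have := coef_muni p m.
  by rewrite -/c c0 mcoeff0 => /esym/eqP; rewrite mleadc_eq0 (negPf p0).
pose q := map_poly (meval v) (muni p).
have q0 : q != 0.
  apply: contraNneq cv => q0; have := congr1 (fun f : {poly K} => f`_(m ord_max)) q0.
  by rewrite coef_map coef0 => /eqP.
have [s [_ _ qs]] := exists_small_nonroot q0 ltr01.
exists (extend_last v s); suff -> : p.@[extend_last v s] = q.[s] by [].
rewrite /meval mmap_muni extend_last_max; congr (_.[_]); apply: eq_map_poly => f.
by apply: meval_eq => i; rewrite extend_last_widen.
Qed.

(** Restricted to the line through the origin and a point where [p] does not vanish, [p] is a
    nonzero univariate polynomial, which has arbitrarily small nonroots. *)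
Lemma mpoly_small_nonvanishing (K : numFieldType) (n : nat) (p : {mpoly K[n]})
    (e : K) : p != 0 -> 0 < e ->
  exists v, (forall i, `|v i| < e) /\ p.@[v] != 0.
Proof.
move=> /mpoly_nonvanishing[v pv] e0.
pose q := mmap polyC (fun i => v i *: 'X) p.
have qE s : q.[s] = p.@[fun i => s * v i].
  have E := @mpoly_rmorph_ext n K K (horner_eval s \o mmap polyC (fun i => v i *: 'X))
    (meval (fun i => s * v i)).
  apply: E => [c|i] /=; rewrite /horner_eval.
    by rewrite mmapC mevalC hornerC.
  by rewrite mmapX mmap1U mevalXU hornerZ hornerX mulrC.
have q0 : q != 0.
  apply: contraNneq pv => q0; have := qE 1; rewrite q0 horner0 => /esym/eqP.
  by rewrite (@meval_eq _ _ _ v) // => i; rewrite mul1r.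
pose B := 1 + \sum_i `|v i|.
have B0 : 0 < B by rewrite ltr_pwDl// sumr_ge0.
have [s [s0 se qs]] := exists_small_nonroot q0 (divr_gt0 e0 B0).
exists (fun i => s * v i); rewrite -qE; split => // i.
rewrite normrM gtr0_norm// (le_lt_trans (y := s * B)) -?ltr_pdivlMr//.
apply: ler_wpM2l; first exact: ltW.
by rewrite /B (bigD1 i) //= [leRHS]addrCA lerDl addr_ge0 ?sumr_ge0.
Qed.

(** * Linear changes of coordinates *)

Section Shear.
Variables (K : numFieldType) (n : nat).
Implicit Types v : 'I_n -> K.

(** Writing [T] for the univariate variable, the last coordinate becomes [T] and each other [x_j]
    becomes [x_j + v_j T]. *)
Definition shear_var v (i : 'I_n.+1) : {poly {mpoly K[n]}} :=
  if unlift ord_max i is Some j then ('X_(j : 'I_n))%:P + (v j)%:MP *: 'X else 'X.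

Definition shear v : {mpoly K[n.+1]} -> {poly {mpoly K[n]}} :=
  mmap (polyC \o @mpolyC n K) (shear_var v).

HB.instance Definition _ v := GRing.RMorphism.on (shear v).

Definition unshear v (p : {poly {mpoly K[n]}}) : {mpoly K[n.+1]} :=
  horner_eval 'X_ord_max (map_poly
    (mmap (@mpolyC n.+1 K) (fun j => 'X_(lift ord_max j) - v j *: 'X_ord_max)) p).

HB.instance Definition _ v := GRing.RMorphism.copy (unshear v)
  (horner_eval 'X_ord_max \o map_poly
    (mmap (@mpolyC n.+1 K) (fun j => 'X_(lift ord_max j) - v j *: 'X_ord_max))).

Lemma shearK v : cancel (shear v) (unshear v).
Proof.
have E := @mpoly_rmorph_ext n.+1 K {mpoly K[n.+1]} (unshear v \o shear v) idfun.
apply: E => [c|i] /=.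
  by rewrite /shear mmapC /unshear /= map_polyC /= mmapC /horner_eval hornerC.
rewrite /shear mmapX mmap1U /shear_var /unshear /horner_eval.
case: unliftP => [j|] -> /=; last by rewrite map_polyX hornerX.
rewrite rmorphD /= map_polyC map_polyZ /= map_polyX mmapX mmapC mmap1U hornerD.
by rewrite hornerC hornerZ hornerX mul_mpolyC subrK.
Qed.

End Shear.

Lemma coef_top_mul (A : comNzRingType) (p q : {poly A}) (a b : nat) :
  (size p <= a.+1)%N -> (size q <= b.+1)%N ->
  (size (p * q)%R <= (a + b).+1)%N /\ (p * q)`_(a + b)%N = p`_a * q`_b.
Proof.
move=> pa qb; split.
  apply: (leq_trans (size_polyMleq _ _)).
  by rewrite -subn1 leq_subLR add1n (leq_trans (leq_add pa qb))// addSn addnS.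
rewrite coefM (bigD1 (inord a)) //= inordK ?ltnS ?leq_addr// addKn.
rewrite big1 ?addr0 // => i; rewrite -val_eqE /= inordK ?ltnS ?leq_addr// => ia.
case: (ltngtP i a) ia => // ia _; last by rewrite (nth_default _ (leq_trans pa ia)) mul0r.
rewrite [q`_ _]nth_default ?mulr0// (leq_trans qb)//.
by rewrite ltn_subRL ltn_add2r.
Qed.

Section ShearMonic.
Variables (K : numFieldType) (n : nat).

Definition ext_one (v : 'I_n -> K) (i : 'I_n.+1) : K := oapp v 1 (unlift ord_max i).

(** Each variable goes to a polynomial of degree at most 1 in [T], whose [T]-coefficient is its
    coordinate at [(v, 1)]; top coefficients multiply. *)
Lemma shear_top_monomial v (m : 'X_{1..n.+1}) :
  (size (shear v 'X_[m]) <= (mdeg m).+1)%N /\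
  (shear v 'X_[m])`_(mdeg m) = ('X_[m].@[ext_one v])%:MP.
Proof.
rewrite /shear mmapX mevalX mdegE /mmap1; elim/big_rec3: _ => /=.
  by rewrite size_poly1 coef1.
move=> i k c p _ [sp pk].
have [sv sk] : (size (shear_var v i ^+ m i) <= (m i).+1)%N /\
    (shear_var v i ^+ m i)`_(m i) = (ext_one v i ^+ m i)%:MP.
  elim: (m i) => [|d [IHs IHc]]; first by rewrite !expr0 size_poly1 coef1.
  have [|] := @coef_top_mul _ (shear_var v i) (shear_var v i ^+ d) 1 d _ IHs.
    rewrite /shear_var; case: unliftP => [j|] _; last by rewrite size_polyX.
    rewrite (leq_trans (size_polyD _ _))// geq_max (leq_trans (size_polyC_leq1 _))//=.
    by rewrite (leq_trans (size_scale_leq _ _))// size_polyX.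
  rewrite add1n -exprS => -> ->; split => //; rewrite IHc exprS mpolyCM; congr (_ * _).
  rewrite /shear_var /ext_one; case: unliftP => [j|] _ /=; last by rewrite coefX.
  by rewrite coefD coefC coefZ coefX add0r mulr1.
have [-> ->] := coef_top_mul sv sp; split => //.
by rewrite sk pk mpolyCM.
Qed.

Lemma shear_top v (q : {mpoly K[n.+1]}) (d := (msize q).-1) :
  (size (shear v q) <= d.+1)%N /\
  (shear v q)`_d = ((pihomog [measure of mdeg] d q).@[ext_one v])%:MP.
Proof.
have sq m : m \in msupp q -> (mdeg m <= d)%N.
  by move=> /msize_mdeg_lt h; rewrite -ltnS (leq_trans h)// leqSpred.
have qE : shear v q = \sum_(m <- msupp q) (q@_m)%:MP *: shear v 'X_[m].
  rewrite {1}(mpolyE q) rmorph_sum; apply: eq_bigr => m _.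
  by rewrite -mul_mpolyC rmorphM /= {1}/shear mmapC /= mul_polyC.
rewrite qE; split.
  rewrite (leq_trans (size_sum _ _ _))// big_seq; apply/bigmax_leqP_seq => m _ mq.
  have [h _] := shear_top_monomial v m.
  by rewrite (leq_trans (size_scale_leq _ _))// (leq_trans h)// ltnS sq.
rewrite pihomogE coef_sum (raddf_sum (meval _)) (raddf_sum (@mpolyC _ _)) /= [RHS]big_mkcond /= big_seq [RHS]big_seq.
apply: eq_bigr => m /sq mq; have [h t] := shear_top_monomial v m.
rewrite coefZ; case: ifP => [/eqP <-|/negbT md]; first by rewrite t mevalZ mpolyCM.
by rewrite nth_default ?mulr0// (leq_trans h)// ltn_neqAle md.
Qed.

Lemma meval_dhomog (d : nat) (q : {mpoly K[n.+1]}) (c : K) w :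
  q \is d.-homog -> q.@[fun i => c * w i] = c ^+ d * q.@[w].
Proof.
move=> /dhomogP hq; rewrite !mevalE mulr_sumr big_seq [RHS]big_seq.
apply: eq_bigr => m /hq <-; rewrite mulrCA; congr (_ * _).
rewrite /= mdegE -prodrXr -big_split /=.
by apply: eq_bigr => i _; rewrite exprMn.
Qed.

(* The leading coefficient is the value of the top form of [q] at [(v, 1)]. *)
Lemma shear_monic (q : {mpoly K[n.+1]}) : q != 0 ->
  exists v c, c != 0 /\ lead_coef (shear v q) = c%:MP.
Proof.
move=> q0; set d := (msize q).-1; pose t := pihomog [measure of mdeg] d q.
have t0 : t != 0.
  have mq : mlead q \in msupp q by rewrite mlead_supp.
  have dq : mdeg (mlead q) = d by rewrite /d -mlead_deg.
  apply: contraTneq mq => t0; rewrite -mcoeff_eq0.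
  have := congr1 (mcoeff (mlead q)) t0; rewrite mcoeff0 /t pihomogE raddf_sum /=.
  rewrite -big_filter (bigD1_seq (mlead q)) ?filter_uniq ?msupp_uniq//=.
    rewrite big1 ?addr0 => [|m /negPf mq]; last by rewrite mcoeffZ mcoeffX mq mulr0.
    by rewrite mcoeffZ mcoeffX eqxx mulr1 => ->.
  by rewrite mem_filter /= dq eqxx mlead_supp.
(* The factor ['X_ord_max] makes the last coordinate of [w] nonzero, so [w] rescales to the form
   [(v, 1)], and by homogeneity [t] stays nonzero there. *)
have [w] : exists w, (t * 'X_ord_max).@[w] != 0.
  by apply: mpoly_nonvanishing; rewrite mulf_neq0// -msize_poly_eq0 msizeX.
rewrite mevalM mevalXU mulf_eq0 negb_or => /andP[tw wm].
pose v j := w (lift ord_max j) / w ord_max.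
exists v, t.@[ext_one v].
have tv : t.@[ext_one v] != 0.
  apply: contraNneq tw => tv.
  rewrite (@meval_eq _ _ _ (fun i => w ord_max * ext_one v i)).
    by rewrite (meval_dhomog _ _ (pihomogP _ _ _)) tv mulr0.
  move=> i; rewrite /ext_one; case: unliftP => [j|] -> /=; last by rewrite mulr1.
  by rewrite /v mulrC divfK.
split => //; have [sd cd] := shear_top v q.
rewrite lead_coefE (_ : (size _).-1 = d) ?cd//.
apply/eqP; rewrite eqn_leq -subn1 leq_subLR add1n sd/= leq_subRL; last first.
  rewrite size_poly_gt0; apply: contraNneq tv => s0.
  by have := cd; rewrite s0 coef0 => /esym/eqP; rewrite mpolyC_eq0.
rewrite add1n ltnNge; apply: contraNN tv => /leq_sizeP/(_ _ (leqnn _)).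
by rewrite cd => /eqP; rewrite mpolyC_eq0.
Qed.

End ShearMonic.

(** * Gauss's lemma for polynomial rings *)

Arguments shear : simpl never.
Arguments unshear : simpl never.
Arguments pihomog : simpl never.

Lemma poly_scale_factor (A : comNzRingType) (d : A) (p : {poly A}) :
  (forall i, exists c, p`_i = d * c) -> exists q, p = d *: q.
Proof.
move=> /choice[c pc]; exists (\poly_(i < size p) c i); apply/polyP => i.
rewrite coefZ coef_poly pc; case: ltnP => // /(nth_default 0).
by rewrite mulr0 pc.
Qed.

Lemma lead_coef_rmorph (A B : nzRingType) (f : {rmorphism A -> B}) (p : {poly A}) :
  f (lead_coef p) != 0 -> lead_coef (map_poly f p) = f (lead_coef p).
Proof. by move=> fp; rewrite lead_coef_map_id0 ?rmorph0. Qed.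

(* Gauss's lemma: every root of [a] divides the content of one of the factors. *)
Lemma gauss_poly (K : closedFieldType) (a : {poly K}) (p q m : {poly {poly K}}) :
  a != 0 -> m \is monic -> a *: m = p * q -> exists p1, p = lead_coef p *: p1.
Proof.
move=> + mm; have [k ak] := ubnP (size a).
elim: k a p q ak => // k IHk a p q ak a0 E.
have [sa|/closed_rootP[x ax]] := eqVneq (size a) 1.
  have := size1_polyC (eq_leq sa); move: (a`_0) => c aC.
  exists (c^-1%:P * lead_coef q *: p).
  have := congr1 lead_coef E; rewrite lead_coefZ (monicP mm) mulr1 lead_coefM => aE.
  rewrite scalerA mulrCA -aE aC -polyCM mulVf ?scale1r//.
  by move: a0; rewrite aC polyC_eq0.
pose l : {poly K} := 'X - x%:P; have l0 : l != 0 by rewrite polyXsubC_eq0.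
have /dvdpP[b aE] : l %| a by rewrite dvdp_XsubCl.
have ev0 (r : {poly {poly K}}) : map_poly (horner_eval x) r = 0 -> exists r', r = l *: r'.
  move=> r0; apply: poly_scale_factor => i.
  have /dvdpP[c ->] : l %| r`_i; last by exists c; rewrite mulrC.
  have := congr1 (fun f : {poly K} => f`_i) r0; rewrite coef_map coef0 => ri.
  by rewrite dvdp_XsubCl; apply/eqP.
have b0 : b != 0 by apply: contraNneq a0 => b0; rewrite aE b0 mul0r.
have sb : (size b < k)%N.
  by move: ak; rewrite aE size_Mmonic ?monicXsubC// size_XsubC addn2 ltnS.
(* Evaluating coefficients at the root [x] of [a] kills [p * q], hence one factor; [l] is then
   cancelled from that factor and from [a]. *)
have : map_poly (horner_eval x) p * map_poly (horner_eval x) q == 0.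
  by rewrite -rmorphM -E /= map_polyZ /= /horner_eval (rootP ax) scale0r.
have lI (r s : {poly {poly K}}) : l *: r = l *: s -> r = s.
  by rewrite -!mul_polyC; apply: mulfI; rewrite polyC_eq0.
rewrite mulf_eq0 => /orP[] /eqP/ev0[r rE].
  have [|p1 rp] := IHk b r q sb b0.
    by apply: lI; rewrite scalerAl -rE -E aE mulrC scalerA.
  by exists p1; rewrite {1}rE {1}rp scalerA rE lead_coefZ.
apply: (IHk b p r sb b0).
by apply: lI; rewrite scalerAr -rE -E aE mulrC scalerA.
Qed.

(* It is enough to divide along the lines in a direction where the leading coefficient of
   [p] is monic, and there [gauss_poly] applies. *)
Lemma gauss_mpoly (K : numClosedFieldType) (n : nat) (a : {mpoly K[n]})
    (p q m : {poly {mpoly K[n]}}) :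
  a != 0 -> m \is monic -> a *: m = p * q ->
  exists2 p1, p1 \is monic & p = lead_coef p *: p1.
Proof.
move=> a0 mm E.
have p0 : p != 0.
  apply/eqP => p0; move: E; rewrite p0 mul0r => /eqP.
  by rewrite -mul_polyC mulf_eq0 polyC_eq0 (negPf a0) (negPf (monic_neq0 mm)).
suff [p1 pE] : exists p1, p = lead_coef p *: p1.
  exists p1 => //; apply/monicP.
  have := congr1 lead_coef pE; rewrite lead_coefZ -{1}[lead_coef p]mulr1.
  by move/mulfI => <- //; rewrite lead_coef_eq0.
case: n a p q m a0 mm E p0 => [|n] a p q m a0 mm E p0.
  pose c := (lead_coef p)@_0%MM.
  have pc : lead_coef p = c%:MP := mpoly0_const _.
  exists (c^-1%:MP *: p); rewrite scalerA pc -mpolyCM mulfV ?scale1r//.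
  by rewrite -(mpolyC_eq0 0) -pc lead_coef_eq0.
apply: poly_scale_factor => i.
have [|v [c [c0 Wc]]] := @shear_monic K n (lead_coef p); first by rewrite lead_coef_eq0.
set W := shear v _ in Wc; pose W' := c^-1%:MP *: W.
have mW' : W' \is monic by apply/monicP; rewrite lead_coefZ Wc -mpolyCM mulVf.
pose d := Pdiv.Ring.rdivp (shear v p`_i) W'; pose r := Pdiv.Ring.rmodp (shear v p`_i) W'.
have rE : shear v p`_i = d * W' + r := Pdiv.RingMonic.rdivp_eq mW' _.
have [r0|r0] := eqVneq r 0.
  exists (unshear v (c^-1%:MP *: d)).
  rewrite -[LHS](shearK v) rE r0 addr0 -[in RHS](shearK v (lead_coef p)) -rmorphM.
  by rewrite -/W -scalerAr mulrC -scalerAr.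
exfalso.
have sr : (size r < size W')%N by rewrite Pdiv.Ring.ltn_rmodp monic_neq0.
pose a' := shear v a.
have a'0 : a' != 0 by apply: contraNneq a0 => a'0; rewrite -(shearK v a) -/a' a'0 rmorph0.
(* At [y] the polynomial [a'] and the remainder [r] stay nonzero, and [r] has smaller degree in [T]
   than [W]; but Gauss's lemma over [K[T]] makes [r] at [y] a multiple of [W] at [y]. *)
have [y] : exists y, (lead_coef r * lead_coef a').@[y] != 0.
  by apply: mpoly_nonvanishing; rewrite mulf_neq0// lead_coef_eq0.
rewrite mevalM mulf_eq0 negb_or => /andP[ry ay].
pose ev : {rmorphism {mpoly K[n.+1]} -> {poly K}} := map_poly (meval y) \o shear v.
have evc : (lead_coef W).@[y] != 0 by rewrite Wc mevalC.
have sW : size (map_poly (meval y) W) = size W by apply: size_map_poly_id0.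
have evW0 : map_poly (meval y) W != 0.
  by rewrite -lead_coef_eq0; rewrite [lead_coef _]lead_coef_rmorph.
have leadp : lead_coef (map_poly ev p) = map_poly (meval y) W.
  by rewrite lead_coef_rmorph.
have [|||p1 p1E] := @gauss_poly K (ev a) (map_poly ev p) (map_poly ev q) (map_poly ev m).
- change (map_poly (meval y) a' != 0); rewrite -lead_coef_eq0.
  rewrite (lead_coef_rmorph (f := meval y) ay); exact: ay.
- by rewrite monic_map.
- by rewrite -map_polyZ E rmorphM.
have : map_poly (meval y) W %| map_poly (meval y) r.
  have -> : r = shear v p`_i - d * W' by rewrite rE addrAC subrr add0r.
  rewrite rmorphB rmorphM; apply: dvdp_sub.
    have := congr1 (fun f : {poly {poly K}} => f`_i) p1E.
    rewrite (coef_map ev) coefZ leadp => evp.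
    change (is_true (map_poly (meval y) W %| ev p`_i)).
    rewrite [ev p`_i]evp.
    by apply: dvdp_mulr.
  apply: dvdp_mull; change (is_true (map_poly (meval y) W %| map_poly (meval y) W')).
  by rewrite map_polyZ [X in X *: _](mevalC y c^-1) dvdpZr// invr_eq0.
rewrite gtNdvdp//.
  rewrite -lead_coef_eq0 (lead_coef_rmorph (f := meval y) ry); exact: ry.
rewrite (leq_ltn_trans (size_poly _ _))// (leq_trans sr)//.
rewrite (leq_trans (size_scale_leq _ _))// -/W.
by rewrite sW.
Qed.

(** * Lying over *)

Section LyingOver.
Variables (B : comNzRingType) (F : fieldType) (K : closedFieldType).
Variables (phi : {rmorphism B -> F}) (psi : {rmorphism B -> K}).
Hypothesis kerS : forall b, phi b = 0 -> psi b = 0.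

(* Nakayama: multiplication by [q] on [B[T]/m] has a determinant killed by [phi],
   and specializing under [psi] to [c ^+ size m]. *)
Lemma specialization_proper (t : F) (m q : {poly B}) (c : K) :
  m \is monic -> root (map_poly phi m) t -> (map_poly phi q).[t] = 0 ->
  map_poly psi q = c%:P -> c = 0.
Proof.
move=> mm mt qt qc.
have sm : (1 < size m)%N.
  rewrite ltnNge; apply/negP => /size1_polyC mE; move: mt (mm).
  rewrite mE monicE lead_coefC => mt' /eqP m1; move: mt'.
  by rewrite m1 map_polyC /= rmorph1 rootC oner_eq0.
pose d := (size m).-2; have dE : size m = d.+2 by rewrite /d; case: (size m) sm => [|[]].
pose D i := Pdiv.Ring.rdivp ('X^i * q) m; pose r i := Pdiv.Ring.rmodp ('X^i * q) m.
have rE i : 'X^i * q = D i * m + r i := Pdiv.RingMonic.rdivp_eq mm _.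
have sr i : (size (r i) <= d.+1)%N.
  by rewrite -ltnS -dE Pdiv.Ring.ltn_rmodp monic_neq0.
pose A : 'M[B]_d.+1 := \matrix_(i, j) (r i)`_j.
have : \det (map_mx phi A) = 0.
  (* The powers of [t] form a nonzero vector killed by the matrix, because [q] and [m] both vanish
     at [t]. *)
  rewrite -det_tr; apply/eqP/det0P; exists (\row_j t ^+ j).
    apply/eqP => /rowP/(_ 0); rewrite !mxE expr0; apply/eqP/oner_neq0.
  apply/rowP => i; rewrite !mxE.
  transitivity (map_poly phi (r i)).[t].
    rewrite (@horner_coef_wide _ d.+1); last exact: leq_trans (size_poly _ _) (sr i).
    by apply: eq_bigr => j _; rewrite !mxE coef_map mulrC.
  have -> : r i = 'X^i * q - D i * m by rewrite rE addrAC subrr add0r.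
  by rewrite rmorphB !rmorphM hornerD hornerN !hornerM qt (rootP mt) !mulr0 subrr.
rewrite det_map_mx => /kerS; rewrite -det_map_mx.
have -> : map_mx psi A = c%:M.
  apply/matrixP => i j; rewrite !mxE.
  have sm' : size (map_poly psi m) = d.+2.
    by rewrite size_map_poly_id0 ?dE// (monicP mm) rmorph1 oner_neq0.
  have : (map_poly psi ('X^i * q)) %% map_poly psi m = map_poly psi (r i).
    rewrite rE rmorphD rmorphM /= modpD modp_mull add0r modp_small// sm' ltnS.
    exact: leq_trans (size_poly _ _) (sr i).
  rewrite rmorphM /= map_polyXn qc mulrC mul_polyC modp_small; last first.
    by rewrite sm' (leq_ltn_trans (size_scale_leq _ _))// size_polyXn ltnS ltn_ord.
  move=> /(congr1 (fun f : {poly K} => f`_j)); rewrite coef_map => <-.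
  by rewrite coefZ coefXn mulr_natr eq_sym.
by rewrite det_scalar => /eqP; rewrite expf_eq0 => /andP[_ /eqP].
Qed.

Hypothesis psi_surj : forall c, exists b, psi b = c.

(** Among the specialized relations of [t], a nonzero one of least degree divides all the others,
    since surjectivity of [psi] lets quotients be lifted. It is not constant, so it has a root. *)
Lemma lying_over1 (t : F) : integralOver phi t ->
  exists s, forall q : {poly B}, (map_poly phi q).[t] = 0 -> (map_poly psi q).[s] = 0.
Proof.
move=> [m mm mt].
pose P k := `[< exists q : {poly B}, [/\ (map_poly phi q).[t] = 0,
  map_poly psi q != 0 & size (map_poly psi q) = k] >].
have exP : exists k, P k.
  exists (size (map_poly psi m)); apply/asboolP; exists m; split => //.
    exact/rootP.
  by rewrite map_poly_eq0_id0 ?(monicP mm) ?rmorph1 ?oner_neq0 ?monic_neq0.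
case: (ex_minnP exP) => k /asboolP[q0 [q0t q00 kE]] kmin.
have dvd q : (map_poly phi q).[t] = 0 -> map_poly psi q0 %| map_poly psi q.
  move=> qt; set e := map_poly psi q0.
  have [D DE] : exists D, map_poly psi D = map_poly psi q %/ e.
    have /choice[g gE] := psi_surj; exists (\poly_(i < size (map_poly psi q %/ e)) g (map_poly psi q %/ e)`_i).
    apply/polyP => i; rewrite coef_map coef_poly; case: ltnP => [_|/(nth_default 0) ->].
      exact: gE.
    exact: rmorph0.
  have rE : map_poly psi (q - D * q0) = map_poly psi q %% e.
    by rewrite rmorphB rmorphM /= DE {1}(divp_eq (map_poly psi q) e) addrAC subrr add0r.
  apply/modp_eq0P/eqP; rewrite -rE; apply: contraT => r0.
  have : P (size (map_poly psi q %% e)).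
    apply/asboolP; exists (q - D * q0); rewrite r0 rE; split => //.
    by rewrite rmorphB rmorphM hornerD hornerN hornerM qt q0t mulr0 subrr.
  by move/kmin; rewrite leqNgt -kE ltn_modp q00.
have [s1|/closed_rootP[s sq0]] := eqVneq (size (map_poly psi q0)) 1; last first.
  by exists s => q /dvd h; apply/rootP; apply: root_dvdp sq0.
have := size1_polyC (eq_leq s1); set c := _`_0 => cE.
have c0 := specialization_proper mm mt q0t cE.
by move: q00; rewrite cE c0 eqxx.
Qed.

End LyingOver.

(** Coordinates are lifted one at a time: the specialization of the first ones takes the place of
    [psi] over the ring [{mpoly B[n]}], and its defining property is the kernel condition. *)
Lemma lying_over (B : comNzRingType) (F : fieldType) (K : closedFieldType)
    (phi : {rmorphism B -> F}) (psi : {rmorphism B -> K}) (n : nat) (xi : 'I_n -> F) :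
  (forall b, phi b = 0 -> psi b = 0) -> (forall c, exists b, psi b = c) ->
  (forall i, integralOver phi (xi i)) ->
  exists x, forall q : {mpoly B[n]}, mmap phi xi q = 0 -> mmap psi x q = 0.
Proof.
move=> kerS psi_surj; elim: n xi => [|n IHn] xi intxi.
  exists (fun=> 0) => q.
  rewrite [q]mpoly0_const.
  by rewrite !mmapC; apply: kerS.
pose xi' i := xi (widen_ord (leqnSn n) i).
have [|x' x'P] := IHn xi'; first by move=> i; apply: intxi.
have [||s sP] := @lying_over1 {mpoly B[n]} F K (mmap phi xi') (mmap psi x') x'P _ (xi ord_max).
- by move=> c; have [b <-] := psi_surj c; exists b%:MP; exact: mmapC.
- have [m mm mt] := intxi ord_max; exists (map_poly (@mpolyC n B) m).
    by rewrite monic_map.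
  rewrite -map_poly_comp (eq_map_poly (g := phi))// => b /=.
  by rewrite mmapC.
exists (extend_last x' s) => q; rewrite !mmap_muni extend_last_max => /sP <-.
by congr (_.[_]); apply: eq_map_poly => p; apply: eq_bigr => a _; congr (_ * _);
  apply: mmap1_eq => i; rewrite extend_last_widen.
Qed.

(** * Noether normalization *)

Lemma integral_mmap (K B : comNzRingType) (F : comNzRingType) (iota : {rmorphism K -> F})
    (rho : {rmorphism B -> F}) (n : nat) (xi : 'I_n -> F) (p : {mpoly K[n]}) :
  (forall c, exists b, iota c = rho b) -> (forall i, integralOver rho (xi i)) ->
  integralOver rho (mmap iota xi p).
Proof.
move=> iotaE intxi; rewrite /mmap; elim/big_ind: _ => [|x y|m _].
- exact: integral0.
- exact: integral_add.
apply: integral_mul; first by have [b ->] := iotaE p@_m; exact: integral_id.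
rewrite /mmap1; elim/big_ind: _ => [|x y|i _].
- exact: integral1.
- exact: integral_mul.
elim: (m i) => [|k IHk]; first by rewrite expr0; exact: integral1.
by rewrite exprS; apply: integral_mul.
Qed.

Section Noether.
Variables (K : numFieldType) (F : fieldType) (iota : {rmorphism K -> F}).

Lemma mmap_shear (n : nat) (v : 'I_n -> K) (xi : 'I_n.+1 -> F) (q : {mpoly K[n.+1]}) :
  mmap iota xi q =
  (map_poly (mmap iota (fun j : 'I_n => xi (lift ord_max j) - iota (v j) * xi ord_max))
    (shear v q)).[xi ord_max].
Proof.
set xi' := fun j : 'I_n => _.
have E := @mpoly_rmorph_ext n.+1 K F (mmap iota xi)
  (horner_eval (xi ord_max) \o map_poly (mmap iota xi') \o shear v).
apply: E => [c|i] /=; rewrite /shear /horner_eval.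
  by rewrite !mmapC /= map_polyC hornerC /= mmapC.
rewrite !mmapX !mmap1U /shear_var; case: unliftP => [j|] ->; last first.
  by rewrite map_polyX hornerX.
rewrite rmorphD /= map_polyC map_polyZ map_polyX hornerD hornerC hornerZ hornerX /=.
by rewrite mmapX mmap1U mmapC /xi' subrK.
Qed.

Lemma mmap_mmap (n d : nat) (xi : 'I_n -> F) (l : 'I_d -> {mpoly K[n]}) (p : {mpoly K[d]}) :
  mmap iota xi (mmap (@mpolyC n K) l p) = mmap iota (fun i => mmap iota xi (l i)) p.
Proof.
have E := @mpoly_rmorph_ext d K F (mmap iota xi \o mmap (@mpolyC n K) l)
  (mmap iota (fun i => mmap iota xi (l i))).
by apply: E => [c|i] /=; rewrite ?mmapC// !mmapX !mmap1U.
Qed.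

Lemma meval_mmap (n d : nat) (x : 'I_n -> K) (l : 'I_d -> {mpoly K[n]}) (p : {mpoly K[d]}) :
  (mmap (@mpolyC n K) l p).@[x] = p.@[fun i => (l i).@[x]].
Proof.
have E := @mpoly_rmorph_ext d K K (meval x \o mmap (@mpolyC n K) l)
  (meval (fun i => (l i).@[x])).
by apply: E => [c|i] /=; rewrite ?mmapC ?mevalC// mmapX mmap1U mevalXU.
Qed.

(** Induction on [n]. If the [xi i] are dependent, a shear makes a relation monic, up to a scalar,
    in the last coordinate, which is then integral over the other sheared coordinates. The [l i]
    vanish at the origin so that the origin lies over [y = 0]. *)
Lemma noether_normalization (n : nat) (xi : 'I_n -> F) :
  exists (d : nat) (l : 'I_d -> {mpoly K[n]}),
  let eta i := mmap iota xi (l i) in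
  [/\ forall i, (l i).@[fun=> 0] = 0,
      forall p : {mpoly K[d]}, mmap iota eta p = 0 -> p = 0
    & forall j, integralOver (mmap iota eta) (xi j)].
Proof.
elim: n xi => [|n IHn] xi.
  exists 0, (fun=> 0); split=> [[]//| p |[]//].
  rewrite [p]mpoly0_const.
  by rewrite mmapC => /eqP; rewrite fmorph_eq0 => /eqP ->; rewrite mpolyC0.
have [indep|] := pselect (forall p : {mpoly K[n.+1]}, mmap iota xi p = 0 -> p = 0).
  exists n.+1, (fun i => 'X_i).
  have eta_xi : (fun i => mmap iota xi 'X_i) = xi by apply/funext => i; rewrite mmapX mmap1U.
  rewrite eta_xi; split => // [i|j]; first by rewrite mevalXU.
  have -> : xi j = mmap iota xi 'X_j by rewrite mmapX mmap1U.
  exact: integral_id.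
move=> /existsNP[q /not_implyP[qxi /eqP q0]].
have [v [c [c0 lc]]] := shear_monic q0.
pose xi' (j : 'I_n) := xi (lift ord_max j) - iota (v j) * xi ord_max.
have [d [l' [l'0 indep intxi']]] := IHn xi'.
pose L (j : 'I_n) : {mpoly K[n.+1]} := 'X_(lift ord_max j) - v j *: 'X_ord_max.
pose l i := mmap (@mpolyC n.+1 K) L (l' i).
have Lxi : (fun j => mmap iota xi (L j)) = xi'.
  by apply/funext => j; rewrite /L rmorphB /= mmapZ !mmapX !mmap1U.
have etaE : (fun i => mmap iota xi (l i)) = (fun i => mmap iota xi' (l' i)).
  by apply/funext => i; rewrite mmap_mmap Lxi.
exists d, l; rewrite /= etaE; split => //.
  move=> i; rewrite meval_mmap -[RHS](l'0 i); apply: meval_eq => j.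
  by rewrite /L mevalB mevalZ !mevalXU mulr0 subr0.
set rho := mmap iota _ in intxi' *.
have iotaE c' : exists b, iota c' = rho b by exists c'%:MP; rewrite /rho mmapC.
have int_max : integralOver rho (xi ord_max).
  (* A monic equation of [xi ord_max]: its coefficients are polynomials in [xi'], hence integral
     over [rho], and integrality is transitive. *)
  pose p := (iota c)^-1 *: map_poly (mmap iota xi') (shear v q).
  have lcp : mmap iota xi' (lead_coef (shear v q)) = iota c by rewrite lc mmapC.
  have lcm : lead_coef (map_poly (mmap iota xi') (shear v q)) = iota c.
    rewrite -lcp; apply: lead_coef_rmorph.
    by rewrite [X in X != 0]lcp fmorph_eq0.
  apply: (@integral_root_monic _ _ _ _ p).
  - by rewrite monicE lead_coefZ lcm mulVf// fmorph_eq0.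
  - by rewrite /root hornerZ -mmap_shear qxi mulr0.
  apply/integral_poly => i; rewrite coefZ coef_map.
  apply: integral_mul; last exact: integral_mmap.
  have [b bE] := iotaE c^-1; rewrite -fmorphV bE; exact: integral_id.
move=> j; case: (unliftP ord_max j) => [k|] ->//.
rewrite -[xi _](subrK (iota (v k) * xi ord_max)); apply: integral_add; first exact: intxi'.
by apply: integral_mul => //; have [b ->] := iotaE (v k); apply: integral_id.
Qed.

End Noether.

(** * Continuity of roots *)

(** The order of [K] is only partial, but positive elements are comparable, so finitely many of them
    have a least one. *)
Lemma positive_lower_bound (K : numFieldType) (s : seq K) :
  {in s, forall x, 0 < x} -> exists2 d, 0 < d & {in s, forall x, d <= x}.
Proof.
elim: s => [|a s IHs] s0; first by exists 1.
have [|d d0 ds] := IHs; first by move=> x xs; apply: s0; rewrite inE xs orbT.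
have a0 : 0 < a by apply: s0; rewrite inE eqxx.
have [ad|da] := real_leP (gtr0_real a0) (gtr0_real d0).
  by exists a => // x /[!inE] /orP[/eqP ->//|/ds]; apply: le_trans.
by exists d => // x /[!inE] /orP[/eqP ->|/ds//]; exact: ltW.
Qed.

(** The absolute value of [p] at [t] is the product of the distances from [t] to the roots, so these
    cannot all be at least [e]. *)
Lemma monic_small_value (K : numClosedFieldType) (p : {poly K}) (t e : K) :
  p \is monic -> 0 < e -> `|p.[t]| < e ^+ (size p).-1 ->
  exists2 z, root p z & `|t - z| < e.
Proof.
move=> mp e0; have [r pE] := closed_field_poly_normal p.
move: pE; rewrite (monicP mp) scale1r => pE.
have [/allP h|] := boolP (all (fun z => e <= `|t - z|) r); last first.
  case/allPn => z zr; rewrite -real_ltNge ?normr_real ?gtr0_real// => tz _.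
  by exists z => //; rewrite pE root_prod_XsubC.
have {}h z : z \in r -> e <= `|t - z| := h z.
rewrite pE horner_prod size_prod_XsubC /= normr_prod.
suff le_prod : e ^+ size r <= \prod_(i <- r) `|('X - i%:P).[t]| by rewrite (le_gtF le_prod).
elim: r h {pE} => [|z r IHr] h; first by rewrite big_nil.
rewrite big_cons [size _]/= exprS ler_pM ?exprn_ge0 ?(ltW e0)//.
  by rewrite hornerXsubC; apply: h; rewrite inE eqxx.
by apply: IHr => x xr; apply: h; rewrite inE xr orbT.
Qed.

(** When [|y i| <= d <= 1], every nonconstant monomial has absolute value at most [d], so the sum of
    the absolute values of the coefficients serves as constant; the added 1 makes it positive. *)
Lemma mpoly_lipschitz (K : numFieldType) (n : nat) (p : {mpoly K[n]}) :
  exists2 C, 0 < C & forall d y, 0 < d -> d <= 1 -> (forall i, `|y i| <= d) ->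
    `|p.@[y] - p.@[fun=> 0]| <= C * d.
Proof.
exists (1 + \sum_(m <- msupp p) `|p@_m|); first by rewrite ltr_pwDl// sumr_ge0.
move=> d y d0 d1 yd; rewrite !mevalE -sumrB mulrDl mul1r ler_wpDl ?(ltW d0)//.
rewrite mulr_suml (le_trans (ler_norm_sum _ _ _))// ler_sum// => m _.
rewrite -mulrBr normrM ler_wpM2l//.
have [->|m0] := eqVneq m 0%MM.
  by rewrite !big1 ?subrr ?normr0 ?ltW// => i _; rewrite mnm0E.
have [i mi] := mnm_neq0_gt0 m0.
have -> : \prod_(i < n) (0 : K) ^+ m i = 0.
  by rewrite (bigD1 i)//= expr0n gtn_eqF// mul0r.
rewrite subr0 normr_prod (bigD1 i)//= -[leRHS]mulr1 ler_pM//.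
- by rewrite prodr_ge0.
- rewrite normrX -(prednK mi) exprS -[leRHS]mulr1 ler_pM ?exprn_ge0// ?exprn_ile1//.
  exact: le_trans (yd i) d1.
apply: prodr_ile1 => j _; rewrite normrX exprn_ge0//= exprn_ile1//.
exact: le_trans (yd j) d1.
Qed.

(** If [|t| > 1 + A], then [|t| > 1] and the lower terms add up to at most [A |t|^(m - 1)], too
    little to cancel [t ^+ m]. *)
Lemma cauchy_root_bound (K : numFieldType) (m : nat) (c : 'I_m -> K) (t A : K) :
  \sum_k `|c k| <= A -> t ^+ m + \sum_(k < m) c k * t ^+ k = 0 -> `|t| <= 1 + A.
Proof.
move=> cA; have A0 : 0 <= A := le_trans (sumr_ge0 _ (fun k _ => normr_ge0 (c k))) cA.
have [//|Tt] := real_leP (normr_real t) (ger0_real (addr_ge0 ler01 A0)).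
have t1 : 1 < `|t| by apply: le_lt_trans Tt; rewrite lerDl.
case: m c cA => [|m] c cA.
  by rewrite big_ord0 addr0 expr0 => /eqP; rewrite oner_eq0.
move/eqP; rewrite addr_eq0 => /eqP/(congr1 Num.norm); rewrite normrN normrX => tE.
have : `|t| ^+ m.+1 <= A * `|t| ^+ m.
  rewrite tE (le_trans (ler_norm_sum _ _ _))//.
  rewrite (le_trans _ (ler_wpM2r (exprn_ge0 m (normr_ge0 t)) cA))// mulr_suml.
  apply: ler_sum => k _; rewrite normrM normrX ler_wpM2l// ler_weXn2l//.
    exact: ltW.
  by rewrite -ltnS.
rewrite exprS ler_pM2r ?exprn_gt0 ?(lt_trans ltr01 t1)// => tA.
by have := lt_le_trans Tt tA; rewrite gtrDr ltr10.
Qed.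

(** The roots at [y] are bounded independently of [y], so the polynomial at 0 takes a small value at
    each of them; a small value of a monic polynomial forces a nearby root. *)
Lemma root_near (K : numClosedFieldType) (n : nat) (p : {poly {mpoly K[n]}}) (e : K) :
  p \is monic -> 0 < e ->
  exists2 d, 0 < d & forall y t, (forall i, `|y i| <= d) ->
    root (map_poly (meval y) p) t ->
    exists2 z, root (map_poly (meval (fun=> 0)) p) z & `|t - z| < e.
Proof.
move=> mp e0.
have ev_monic y : map_poly (meval y) p \is monic by rewrite monic_map.
have ev_size y : size (map_poly (meval y) p) = size p.
  by apply: size_map_poly_id0; rewrite (monicP mp) [X in X != 0](rmorph1 (meval y)) oner_neq0.
set m := (size p).-1; have sp : size p = m.+1 by rewrite prednK// size_poly_gt0 monic_neq0.
have /choice[C C0] : forall k : nat, exists C, 0 < C /\ forall d y, 0 < d -> d <= 1 ->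
    (forall i, `|y i| <= d) -> `|(p`_k).@[y] - (p`_k).@[fun=> 0]| <= C * d.
  by move=> k; have [C] := mpoly_lipschitz p`_k; exists C.
(* For [d <= 1], [A] bounds the sum of the absolute values of the lower coefficients at [y], so [T]
   bounds the roots, and [D * d] bounds the change of value at a root. *)
pose A := \sum_(k < m) (C k + `|(p`_k).@[fun=> 0]|); pose S := \sum_(k < m) C k.
have S_ge0 : 0 <= S by rewrite sumr_ge0// => k _; rewrite ltW//; case: (C0 k).
have A_ge0 : 0 <= A.
  by rewrite sumr_ge0// => k _; rewrite addr_ge0// ltW//; case: (C0 k).
pose T := 1 + A; have T1 : 1 <= T by rewrite lerDl.
have T0 : 0 < T := lt_le_trans ltr01 T1.
pose D := (S + 1) * T ^+ m; have D0 : 0 < D by rewrite mulr_gt0 ?exprn_gt0// ltr_wpDl.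
have [|d d0 dP] := @positive_lower_bound K [:: 1; e ^+ m / (D + 1)].
  by move=> x /[!inE] /orP[/eqP ->//|/eqP ->]; rewrite divr_gt0 ?exprn_gt0 ?addr_gt0.
have d1 : d <= 1 by apply: dP; rewrite inE eqxx.
have dD : D * d < e ^+ m.
  apply: (@lt_le_trans _ _ ((D + 1) * d)); first by rewrite ltr_pM2r// ltrDl.
  by rewrite mulrC -ler_pdivlMr ?addr_gt0//; apply: dP; rewrite !inE eqxx orbT.
exists d => // y t yd rt; apply: (monic_small_value (ev_monic _) e0).
rewrite ev_size -/m.
have pk k : `|(p`_k).@[y] - (p`_k).@[fun=> 0]| <= C k * d by have [_] := C0 k; apply.
have hornerE z : (map_poly (meval z) p).[t] = t ^+ m + \sum_(k < m) (p`_k).@[z] * t ^+ k.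
  rewrite (@horner_coef_wide _ m.+1) ?ev_size ?sp// big_ord_recr /= addrC; congr (_ + _).
    have := ev_monic z; rewrite monicE lead_coefE ev_size -/m => /eqP ->.
    by rewrite mul1r.
  by apply: eq_bigr => k _; rewrite coef_map.
have tT : `|t| <= T.
  apply: (@cauchy_root_bound _ m (fun k => (p`_k).@[y])); last by rewrite -hornerE (rootP rt).
  apply: ler_sum => k _; rewrite -[X in `|X|](subrK ((p`_k).@[fun=> 0])).
  apply: le_trans (ler_normD _ _) _; rewrite lerD2r (le_trans (pk k))//.
  by rewrite ler_piMr//; case: (C0 k) => /ltW.
have -> : (map_poly (meval (fun=> 0)) p).[t] =
    \sum_(k < m) ((p`_k).@[fun=> 0] - (p`_k).@[y]) * t ^+ k.
  transitivity ((map_poly (meval (fun=> 0)) p).[t] - (map_poly (meval y) p).[t]).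
    by rewrite (rootP rt) subr0.
  rewrite !hornerE opprD addrACA subrr add0r -sumrB.
  by apply: eq_bigr => k _; rewrite mulrBl.
apply: le_lt_trans dD; rewrite (le_trans (ler_norm_sum _ _ _))//.
rewrite (@le_trans _ _ (\sum_(k < m) C k * d * T ^+ m))//.
  apply: ler_sum => k _; rewrite normrM ler_pM// ?normrX; first by rewrite distrC.
  rewrite (@le_trans _ _ (T ^+ k))//; first by rewrite lerXn2r// nnegrE// ltW.
  by rewrite ler_weXn2l// ltnW.
rewrite -!mulr_suml -/S /D -mulrA [d * _]mulrC mulrA ler_pM2r//.
by rewrite ler_pM2r ?exprn_gt0// lerDl.
Qed.

(** The value at 0 is the constant coefficient, which vanishes at [y = 0] and is therefore small for
    small [y]. *)
Lemma exists_small_root (K : numClosedFieldType) (n : nat) (p : {poly {mpoly K[n]}})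
    (e : K) : p \is monic -> (p`_0).@[fun=> 0] = 0 -> 0 < e ->
  exists2 d, 0 < d & forall y, (forall i, `|y i| <= d) ->
    exists2 z, root (map_poly (meval y) p) z & `|z| < e.
Proof.
move=> mp p00 e0; have [C C0 CP] := mpoly_lipschitz p`_0.
set m := (size p).-1.
have [|d d0 dP] := @positive_lower_bound K [:: 1; e ^+ m / (C + 1)].
  by move=> x /[!inE] /orP[/eqP ->//|/eqP ->]; rewrite divr_gt0 ?exprn_gt0 ?addr_gt0.
have d1 : d <= 1 by apply: dP; rewrite inE eqxx.
exists d => // y yd.
have mpy : map_poly (meval y) p \is monic by rewrite monic_map.
have [|z rz] := @monic_small_value K _ 0 e mpy e0; last first.
  by rewrite sub0r normrN; exists z.
rewrite horner_coef0 coef_map size_map_poly_id0; last first.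
  by rewrite (monicP mp) [X in X != 0](rmorph1 (meval y)) oner_neq0.
have := CP d y d0 d1 yd; rewrite p00 subr0 => /le_lt_trans; apply.
apply: (@lt_le_trans _ _ ((C + 1) * d)); first by rewrite ltr_pM2r// ltrDl.
by rewrite mulrC -ler_pdivlMr ?addr_gt0//; apply: dP; rewrite !inE eqxx orbT.
Qed.

(** * Specializations near the origin *)

(* A relation of least degree is monic up to a scalar by Gauss's lemma, so the ideal
   of relations of an integral element over a polynomial ring is principal. *)
Lemma integral_relations_principal (K : numClosedFieldType) (F : fieldType) (d : nat)
    (rho : {rmorphism {mpoly K[d]} -> F}) (t : F) :
  (forall b, rho b = 0 -> b = 0) -> integralOver rho t ->
  exists h : {poly {mpoly K[d]}}, [/\ h \is monic, (map_poly rho h).[t] = 0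
    & forall q, (map_poly rho q).[t] = 0 -> exists D, q = D * h].
Proof.
move=> rho_inj [m mm /rootP mt].
pose P k := `[< exists q : {poly {mpoly K[d]}},
  [/\ (map_poly rho q).[t] = 0, q != 0 & size q = k] >].
have exP : exists k, P k by exists (size m); apply/asboolP; exists m; rewrite monic_neq0.
case: (ex_minnP exP) => k /asboolP[p [pt p0 kE]] kmin.
have small q : (map_poly rho q).[t] = 0 -> (size q < k)%N -> q = 0.
  move=> qt sq; apply/eqP; apply: contraTT sq => q0; rewrite -leqNgt; apply: kmin.
  by apply/asboolP; exists q.
(* In the pseudo-division of the monic equation [m] by [p], the remainder vanishes by minimality, so
   [p] is a factor of [a *: m] and Gauss's lemma applies. *)
pose a := lead_coef p ^+ Pdiv.Idomain.scalp m p.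
have a0 : a != 0 by rewrite expf_neq0// lead_coef_eq0.
have mE := Pdiv.Idomain.divp_eq m p.
have r0 : Pdiv.Idomain.modp m p = 0.
  apply: small; last by rewrite -kE Pdiv.Idomain.ltn_modp.
  have -> : Pdiv.Idomain.modp m p = a *: m - Pdiv.Idomain.divp m p * p.
    by rewrite mE addrAC subrr add0r.
  rewrite -mul_polyC rmorphB !rmorphM hornerD hornerN !hornerM pt mt.
  by rewrite !mulr0 subr0.
move: mE; rewrite r0 addr0 mulrC => mE.
have [h mh pE] := gauss_mpoly a0 mm mE.
have ht : (map_poly rho h).[t] = 0.
  move: pt; rewrite pE map_polyZ hornerZ => /eqP; rewrite mulf_eq0 => /orP[/eqP/rho_inj|/eqP//].
  by move/eqP; rewrite lead_coef_eq0 (negPf p0).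
have sh : size h = k.
  by rewrite -kE pE -mul_polyC size_proper_mul ?lead_coefC ?(monicP mh) ?mulr1 ?lead_coef_eq0// size_polyC lead_coef_eq0 p0.
exists h; split => // q qt.
have qE := Pdiv.RingMonic.rdivp_eq mh q.
exists (Pdiv.Ring.rdivp q h); rewrite {1}qE.
have -> : Pdiv.Ring.rmodp q h = 0; last by rewrite addr0.
apply: small; last by rewrite -sh Pdiv.Ring.ltn_rmodp monic_neq0.
have -> : Pdiv.Ring.rmodp q h = q - Pdiv.Ring.rdivp q h * h.
  by rewrite {2}qE addrAC subrr add0r.
by rewrite rmorphB rmorphM hornerD hornerN hornerM qt ht mulr0 subr0.
Qed.

(** As [t] is nonzero, factors [X] can be removed from its equation. Where the constant term does
    not vanish, a specialization of [t] cannot vanish either. *)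
Lemma integral_nonzero_constant (B : idomainType) (F : fieldType)
    (rho : {rmorphism B -> F}) (t : F) :
  t != 0 -> integralOver rho t -> exists2 p : {poly B}, p`_0 != 0 & (map_poly rho p).[t] = 0.
Proof.
move=> t0 [m /monic_neq0 + /rootP]; elim/poly_ind: m => [|p c IHp]; first by rewrite eqxx.
have [->|c0] := eqVneq c 0; last first.
  by exists (p * 'X + c%:P) => //; rewrite coefD coefMX coefC add0r.
rewrite addr0 => pX; rewrite rmorphM /= map_polyX hornerMX => /eqP.
rewrite mulf_eq0 (negPf t0) orbF => /eqP; apply: IHp.
by apply: contraNneq pX => ->; rewrite mul0r.
Qed.

(** Each of the finitely many nonzero points [z] with coordinates in [s] gives a nonzero linear form
    in [lam]. A point where the product of these forms is nonzero serves as [lam], and [e] bounds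
    the values from below. *)
Lemma linear_form_separating (K : numFieldType) (n : nat) (s : seq K) :
  exists lam : 'I_n -> K, exists2 e, 0 < e & forall z : 'I_n -> K,
    (forall i, z i \in s) -> `|\sum_i lam i * z i| < e -> forall i, z i = 0.
Proof.
pose T := {ffun 'I_n -> seq_sub s}.
pose L (z : T) : {mpoly K[n]} := \sum_i ssval (z i) *: 'X_i.
pose nz := [pred z : T | [exists i, ssval (z i) != 0]].
have L0 z : nz z -> L z != 0.
  case/existsP => i zi; apply: contraNneq zi => Lz.
  have := congr1 (mcoeff U_(i)) Lz; rewrite mcoeff0 raddf_sum /= (bigD1 i)//= big1.
    by rewrite addr0 mcoeffZ mcoeffX eqxx mulr1 => ->.
  move=> j ji; rewrite mcoeffZ mcoeffX; case: eqP => [/(congr1 (fun m : 'X_{1..n} => m i))|].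
    by rewrite !mnm1E eqxx (negPf ji).
  by rewrite mulr0.
have [lam lamP] : exists lam, (\prod_(z : T | nz z) L z).@[lam] != 0.
  by apply: mpoly_nonvanishing; apply/prodf_neq0 => z /L0.
have Llam z : nz z -> 0 < `|(L z).@[lam]|.
  move=> zz; rewrite normr_gt0; apply: contraNneq lamP => Lz.
  by rewrite rmorph_prod (bigD1 z)//= Lz mul0r.
exists lam.
have [|e e0 eP] := @positive_lower_bound K [seq `|(L z).@[lam]| | z <- enum nz].
  by move=> _ /mapP[z + ->]; rewrite mem_enum => /Llam.
exists e => // z zs zlt i; apply/eqP; apply: contraTT zlt => zi.
pose z' : T := [ffun i => SeqSub (zs i)].
have nz' : nz z' by apply/existsP; exists i; rewrite ffunE.
rewrite -real_leNgt ?normr_real ?(gtr0_real e0)//.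
have -> : \sum_i lam i * z i = (L z').@[lam].
  by rewrite raddf_sum; apply: eq_bigr => j _; rewrite /= mevalZ mevalXU ffunE mulrC.
by apply: eP; apply: map_f; rewrite mem_enum.
Qed.

(** The coordinates of a point over a small [y] are close to roots [z j] of the equations [M j] at
    [y = 0]. Making the linear form [w] small at that point forces all [z j] to be 0. *)
Lemma specialization_near (K : numClosedFieldType) (F : fieldType)
    (iota : {rmorphism K -> F}) (n : nat) (xi : 'I_n -> F) (g : {mpoly K[n]}) (e : K) :
  (forall p : {mpoly K[n]}, mmap iota xi p = 0 -> p.@[fun=> 0] = 0) ->
  mmap iota xi g != 0 -> 0 < e ->
  exists x, [/\ forall i, `|x i| < e,
    forall p : {mpoly K[n]}, mmap iota xi p = 0 -> p.@[x] = 0 & g.@[x] != 0].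
Proof.
move=> xi0 gxi e0.
have [d [l [l0 indep intxi]]] := noether_normalization iota xi.
set eta := fun i => _ in indep intxi; set rho := mmap iota eta in indep intxi.
have iotaE c : exists b, iota c = rho b by exists c%:MP; rewrite /rho mmapC.
have /choice[M /all_and2[monM rootM]] : forall j, exists m : {poly {mpoly K[d]}},
    m \is monic /\ root (map_poly rho m) (xi j).
  by move=> j; have [m mm mt] := intxi j; exists m.
have [G G0 Gg] := integral_nonzero_constant gxi (integral_mmap g iotaE intxi).
have [s sP] : exists s : seq K, forall j z,
    root (map_poly (meval (fun=> 0)) (M j)) z -> z \in s.
  have /choice[s sP] : forall j, exists s : seq K, forall z,
      root (map_poly (meval (fun=> 0)) (M j)) z -> z \in s.
    move=> j; have [s E] := closed_field_poly_normal (map_poly (meval (fun=> 0)) (M j)).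
    exists s => z; rewrite E (monicP _) ?monic_map// scale1r.
    by rewrite root_prod_XsubC.
  exists (flatten [seq s j | j <- enum 'I_n]) => j z /sP zs.
  by apply/flattenP; exists (s j) => //; apply: map_f; rewrite mem_enum.
have [lam [e1 e10 lamP]] := linear_form_separating n s.
pose w : {mpoly K[n]} := \sum_i lam i *: 'X_i.
pose theta := mmap iota xi w.
have [H [monH Htheta Hprinc]] :=
  integral_relations_principal indep (integral_mmap w iotaE intxi).
(* Substituting [l] and [w] in [H] gives a polynomial that vanishes at [xi], hence at the origin;
   since [l] and [w] vanish there, its value is the constant coefficient of [H] at [y = 0]. *)
have H00 : (H`_0).@[fun=> 0] = 0.
  pose p := (map_poly (mmap (@mpolyC n K) l) H).[w].
  have : p.@[fun=> 0] = 0.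
    apply: xi0; rewrite -[RHS]Htheta /p.
    rewrite -(horner_map (mmap iota xi)) -map_poly_comp; congr (_.[_]).
    by apply: eq_map_poly => b /=; rewrite mmap_mmap.
  rewrite -(horner_map (meval _)) -map_poly_comp /=.
  have -> : w.@[fun=> 0] = 0.
    by rewrite raddf_sum big1//= => i _; rewrite mevalZ mevalXU mulr0.
  rewrite horner_coef0 coef_map /= meval_mmap => H0; apply: etrans H0.
  by apply: meval_eq => i; rewrite l0.
pose S := 1 + \sum_i `|lam i|.
have S0 : 0 < S by rewrite ltr_pwDl// sumr_ge0.
(* One half of [e1] is kept for [|t|], the other for the change of the linear form when each
   coordinate moves by less than [e2]. *)
have [|e2 e20 e2P] := @positive_lower_bound K [:: e; e1 / 2 / S].
  by move=> x /[!inE] /orP[/eqP ->//|/eqP ->]; rewrite !divr_gt0.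
have e2e : e2 <= e by apply: e2P; rewrite inE eqxx.
have e2S : S * e2 <= e1 / 2.
  by rewrite mulrC -ler_pdivlMr//; apply: e2P; rewrite !inE eqxx orbT.
have /choice[dl /all_and2[dl0 dlP]] : forall j, exists dj, 0 < dj /\
    forall y t, (forall i, `|y i| <= dj) -> root (map_poly (meval y) (M j)) t ->
    exists2 z, root (map_poly (meval (fun=> 0)) (M j)) z & `|t - z| < e2.
  by move=> j; have [dj ? ?] := root_near (monM j) e20; exists dj.
have [dH dH0 dHP] := exists_small_root monH H00 (divr_gt0 e10 (ltr0n _ 2)).
have [|dd dd0 ddP] := @positive_lower_bound K (dH :: [seq dl j | j <- enum 'I_n]).
  by move=> x /[!inE] /orP[/eqP ->//|/mapP[j _ ->]].
have [y [yd yG]] := mpoly_small_nonvanishing G0 dd0.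
have [|t tH te] := dHP y.
  by move=> i; rewrite (le_trans (ltW (yd i)))// ddP// inE eqxx.
(* Both morphisms start from [K[y][T]], with [T] sent to [theta] and to [t]. The kernel of [phi] is
   generated by [H], and [t] is a root of [H] at [y], so lying over applies. *)
pose phi : {rmorphism {poly {mpoly K[d]}} -> F} := horner_eval theta \o map_poly rho.
pose psi : {rmorphism {poly {mpoly K[d]}} -> K} := horner_eval t \o map_poly (meval y).
have [|||x xP] := @lying_over _ _ _ phi psi n xi.
- move=> q /Hprinc[D ->]; rewrite rmorphM.
  have -> : psi H = 0 by exact/rootP.
  by rewrite mulr0.
- move=> c; exists c%:MP%:P.
  by rewrite /psi /= map_polyC /horner_eval hornerC /= mevalC.
- move=> j; exists (map_poly polyC (M j)); first by rewrite monic_map.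
  rewrite -map_poly_comp (eq_map_poly (g := rho))// => b /=.
  by rewrite map_polyC /horner_eval hornerC.
(* Relations over [K[y][T]] of any polynomial [q] in the coordinates specialize as well. For [w] and
   the relation [X - T] this gives the value [t] of [w] at [x]. *)
have {}xP (P : {poly {poly {mpoly K[d]}}}) (q : {mpoly K[n]}) :
    (map_poly phi P).[mmap iota xi q] = 0 -> (map_poly psi P).[q.@[x]] = 0.
  pose k : {rmorphism K -> {poly {mpoly K[d]}}} := polyC \o @mpolyC d K.
  pose wq := mmap (@mpolyC n {poly {mpoly K[d]}} \o k) (fun i => 'X_i) q.
  have phiq : mmap phi xi wq = mmap iota xi q.
    have E := @mpoly_rmorph_ext n K F
      (mmap phi xi \o mmap (@mpolyC n {poly {mpoly K[d]}} \o k) (fun i => 'X_i)) (mmap iota xi).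
    apply: E => [c|i] /=; rewrite ?mmapC /=; last by rewrite !mmapX !mmap1U mmapX mmap1U.
    by rewrite map_polyC /horner_eval hornerC /= mmapC.
  have psiq : mmap psi x wq = q.@[x].
    have E := @mpoly_rmorph_ext n K K
      (mmap psi x \o mmap (@mpolyC n {poly {mpoly K[d]}} \o k) (fun i => 'X_i)) (meval x).
    apply: E => [c|i] /=; rewrite ?mmapC /=; last by rewrite !mmapX !mmap1U mmapX mmap1U mevalXU.
    by rewrite map_polyC /horner_eval hornerC /= !mevalC.
  have := xP (map_poly (@mpolyC n _) P).[wq].
  have -> : mmap phi xi (map_poly (@mpolyC n _) P).[wq] = (map_poly phi P).[mmap iota xi q].
    rewrite -phiq -[LHS](horner_map (mmap phi xi)) -map_poly_comp; congr (_.[_]).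
    by apply: eq_map_poly => b; rewrite [LHS](mmapC xi phi).
  have -> // : mmap psi x (map_poly (@mpolyC n _) P).[wq] = (map_poly psi P).[q.@[x]].
  rewrite -psiq -[LHS](horner_map (mmap psi x)) -map_poly_comp; congr (_.[_]).
  by apply: eq_map_poly => b; rewrite [LHS](mmapC x psi).
have wx : \sum_i lam i * x i = t.
  have phiX : phi 'X = theta by rewrite /phi /= map_polyX /horner_eval hornerX.
  have psiX : psi 'X = t by rewrite /psi /= map_polyX /horner_eval hornerX.
  have := xP ('X - 'X%:P) w; rewrite !map_polyXsubC !hornerXsubC phiX psiX subrr.
  move=> /(_ erefl)/eqP.
  rewrite subr_eq0 => /eqP <-.
  by rewrite raddf_sum; apply: eq_bigr => i _; rewrite /= mevalZ mevalXU.
have {}xP (P : {poly {mpoly K[d]}}) (q : {mpoly K[n]}) :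
    (map_poly rho P).[mmap iota xi q] = 0 -> (map_poly (meval y) P).[q.@[x]] = 0.
  have := xP (map_poly polyC P) q; rewrite -!map_poly_comp.
  rewrite (eq_map_poly (g := rho)); first last.
    by move=> b /=; rewrite map_polyC /horner_eval hornerC.
  rewrite (eq_map_poly (g := meval y))// => b /=.
  by rewrite map_polyC /horner_eval hornerC.
have Mx j : exists2 z, root (map_poly (meval (fun=> 0)) (M j)) z & `|x j - z| < e2.
  apply: (dlP j y) => [i|].
    rewrite (le_trans (ltW (yd i)))// ddP// inE; apply/orP; right.
    by apply: map_f; rewrite mem_enum.
  have := xP (M j) 'X_j; rewrite mevalXU mmapX mmap1U => h.
  by apply/rootP/h/rootP.
have /choice[z /all_and2[zM xz]] : forall j, exists z,
    root (map_poly (meval (fun=> 0)) (M j)) z /\ `|x j - z| < e2.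
  by move=> j; have [z] := Mx j; exists z.
have z0 : forall i, z i = 0.
  apply: lamP; first by move=> i; apply: sP (zM i).
  have -> : \sum_i lam i * z i = t - \sum_i lam i * (x i - z i).
    by rewrite -wx -sumrB; apply: eq_bigr => i _; rewrite mulrBr opprB addrC subrK.
  rewrite (splitr e1) (le_lt_trans (ler_normB _ _))// ltr_leD//.
  apply: le_trans e2S; rewrite /S mulrDl mul1r ler_wpDl ?(ltW e20)//.
  rewrite mulr_suml (le_trans (ler_norm_sum _ _ _))// ler_sum// => i _.
  by rewrite normrM ler_wpM2l// ltW.
exists x; split.
- by move=> i; apply: lt_le_trans e2e; have := xz i; rewrite z0 subr0.
- move=> p pxi; have := xP 'X p; rewrite !map_polyX !hornerX; exact.
(* If [g] vanished at [x], its equation [G] would specialize to the vanishing of the constant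
   coefficient of [G] at [y]. *)
apply: contraNneq yG => gx; have := xP G g Gg.
by rewrite gx horner_coef0 coef_map => ->.
Qed.

(** * The Nullstellensatz at the origin *)

Section PrimeQuotient.
Variables (R : comNzRingType) (P : set R).
Hypotheses (P0 : P 0) (PD : forall x y, P x -> P y -> P (x + y))
  (PM : forall a x, P x -> P (a * x)) (P1 : ~ P 1)
  (Pprime : forall x y, P (x * y) -> P x \/ P y).

Definition in_prime : {pred R} := fun x => `[< P x >].

Fact in_prime_closed : idealr_closed in_prime.
Proof.
split; [exact/asboolP|exact/asboolP|move=> a x y /asboolP Px /asboolP Py].
by apply/asboolP; apply: PD => //; apply: PM.
Qed.

Fact in_prime_prime : prime_idealr_closed in_prime.
Proof. by move=> x y /asboolP/Pprime[] /asboolP h; apply/orP; [left|right]. Qed.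

HB.instance Definition _ := isIdealr.Build R in_prime in_prime_closed.
HB.instance Definition _ := isPrimeIdealrClosed.Build R in_prime in_prime_prime.

Definition prime_quot : Type := {ideal_quot in_prime}.
HB.instance Definition _ := GRing.ComNzRing.on prime_quot.

(** Inverses are chosen classically to give the quotient the unit ring structure that an integral
    domain carries; its fraction field can then be formed. *)
Definition quot_unit : pred prime_quot := fun x => `[< exists y, y * x = 1 >].

Definition quot_inv (x : prime_quot) : prime_quot :=
  if pselect (exists y, y * x = 1) is left h then projT1 (cid h) else x.

Fact quot_mulVr : {in quot_unit, left_inverse 1 quot_inv *%R}.
Proof.
move=> x /asboolP h; rewrite /quot_inv; case: pselect => // h'.
exact: (projT2 (cid h')).
Qed.

Fact quot_unitPl (x y : prime_quot) : y * x = 1 -> quot_unit x.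
Proof. by move=> xy; apply/asboolP; exists y. Qed.

Fact quot_inv_out : {in [predC quot_unit], quot_inv =1 id}.
Proof.
move=> x /negP h; rewrite /quot_inv; case: pselect => // h'.
by exfalso; apply: h; apply/asboolP.
Qed.

HB.instance Definition _ := GRing.ComNzRing_hasMulInverse.Build prime_quot
  quot_mulVr quot_unitPl quot_inv_out.

Fact quot_integral : GRing.integral_domain_axiom prime_quot.
Proof. exact: Quotient.rquot_IdomainAxiom. Qed.

HB.instance Definition _ := GRing.ComUnitRing_isIntegral.Build prime_quot quot_integral.

Lemma prime_ideal_kernel :
  exists (F : fieldType) (phi : {rmorphism R -> F}), forall x, phi x = 0 <-> P x.
Proof.
pose pi : {rmorphism R -> prime_quot} := \pi_({ideal_quot in_prime})%qT.
exists {fraction prime_quot}, (@tofrac prime_quot \o pi) => x /=.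
have piE : (pi x == 0) = (x \in in_prime).
  by rewrite -[x in RHS]subr0 Quotient.idealrBE -[0 in LHS](rmorph0 pi).
split=> [/eqP|Px].
  by rewrite tofrac_eq0 piE => /asboolP.
by apply/eqP; rewrite tofrac_eq0 piE; apply/asboolP.
Qed.

End PrimeQuotient.

Record is_ideal (R : comNzRingType) (J : set R) : Prop := IsIdeal {
  ideal0 : J 0;
  idealD : forall x y, J x -> J y -> J (x + y);
  idealM : forall a x, J x -> J (a * x) }.

(** An ideal [P] maximal among those that contain [I] and avoid [S] is prime: if [x] and [y] are
    outside [P], both [P + (x)] and [P + (y)] meet [S], and if [x * y] were in [P], the product of
    the two common elements would be too. *)
Lemma prime_ideal_avoiding (R : comNzRingType) (I S : set R) :
  is_ideal I -> S 1 -> (forall x y, S x -> S y -> S (x * y)) ->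
  (forall x, S x -> ~ I x) ->
  exists P, [/\ is_ideal P, I `<=` P, forall x, S x -> ~ P x
    & forall x y, P (x * y) -> P x \/ P y].
Proof.
move=> idI S1 SM SI.
pose good (J : set R) := [/\ is_ideal J, I `<=` J & forall x, S x -> ~ J x].
have [|P [+ Pmax]] := @Zorn_bigcup R [set J | J = set0 \/ good J].
  move=> F FP Ftot.
  have [[J0 [FJ0 gJ0]]|none] := pselect (exists J, F J /\ good J); last first.
    left; apply/seteqP; split => // x [J FJ Jx].
    by have [J0|gJ] := FP _ FJ; [rewrite J0 in Jx|case: none; exists J].
  have chain J1 J2 : F J1 -> F J2 -> J1 `<=` J2 \/ J2 `<=` J1 := Ftot J1 J2.
  have idF J x : F J -> J x -> is_ideal J.
    by move=> FJ Jx; have [J00|[]//] := FP _ FJ; rewrite J00 in Jx.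
  have [idJ0 IJ0 SJ0] := gJ0.
  right; split; first split.
  - by exists J0 => //; apply: ideal0.
  - move=> x y [J1 F1 J1x] [J2 F2 J2y].
    have [J12|J21] := chain _ _ F1 F2.
      by exists J2 => //; apply: (idealD (idF _ _ F2 J2y)) => //; apply: J12.
    by exists J1 => //; apply: (idealD (idF _ _ F1 J1x)) => //; apply: J21.
  - by move=> a x [J FJ Jx]; exists J => //; apply: (idealM (idF _ _ FJ Jx)).
  - by move=> x Ix; exists J0 => //; apply: IJ0.
  - by move=> x Sx [J FJ Jx]; have [J00|[_ _ /(_ x Sx)]//] := FP _ FJ; rewrite J00 in Jx.
case=> [P0|[idP IP SP]].
  exfalso; apply: (Pmax I); last by right; split.
  rewrite P0; split=> //.
  by move=> /(_ 0 (ideal0 idI)).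
exists P; split=> // x y Pxy; apply: contrapT => /not_orP[Px Py].
have meet a : ~ P a -> exists s p r, [/\ S s, P p & s = p + r * a].
  move=> Pa; pose J := [set z | exists p r, P p /\ z = p + r * a].
  apply: contrapT => nomeet; apply: (Pmax J); last first.
    right; split; first split.
    - by exists 0, 0; rewrite mul0r addr0; split => //; apply: ideal0.
    - move=> _ _ [p [r [Pp ->]]] [q [t [Pq ->]]]; exists (p + q), (r + t).
      by split; [apply: idealD|rewrite mulrDl addrACA].
    - move=> b _ [p [r [Pp ->]]]; exists (b * p), (b * r).
      by split; [apply: idealM|rewrite mulrDr mulrA].
    - by move=> z Iz; exists z, 0; rewrite mul0r addr0; split => //; apply: IP.
    - by move=> s Ss [p [r [Pp sE]]]; apply: nomeet; exists s, p, r.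
  split=> [z Pz|JP]; first by exists z, 0; rewrite mul0r addr0.
  by apply: Pa; apply: JP; exists 0, 1; rewrite mul1r add0r; split => //; apply: ideal0.
have [s1 [p1 [r1 [Ss1 Pp1 E1]]]] := meet _ Px.
have [s2 [p2 [r2 [Ss2 Pp2 E2]]]] := meet _ Py.
apply: (SP (s1 * s2)); first exact: SM.
rewrite E2 mulrDr; apply: (idealD idP); first exact: (idealM idP).
rewrite E1 mulrDl; apply: (idealD idP); first by rewrite mulrC; exact: (idealM idP).
by rewrite mulrACA; apply: (idealM idP).
Qed.

(* The Nullstellensatz at the origin for polynomials, with the zero set only known in a
   Euclidean neighbourhood. *)
Lemma local_nullstellensatz (K : numClosedFieldType) (n : nat)
    (I : set {mpoly K[n]}) (g : {mpoly K[n]}) (e : K) :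
  is_ideal I -> 0 < e ->
  (forall x, (forall i, `|x i| < e) -> (forall p, I p -> p.@[x] = 0) -> g.@[x] = 0) ->
  exists u k, u.@[fun=> 0] != 0 /\ I (u * g ^+ k).
Proof.
move=> idI e0 gI; apply: contrapT => none.
pose S := [set s | exists u k, u.@[fun=> 0] != 0 /\ s = u * g ^+ k].
have [|||P [idP IP SP Pprime]] := prime_ideal_avoiding (S := S) idI.
- by exists 1, 0; rewrite meval1 oner_neq0 expr0 mulr1.
- move=> _ _ [u [k [u0 ->]]] [v [m [v0 ->]]]; exists (u * v), (k + m)%N.
  by rewrite mevalM mulf_neq0// exprD mulrACA.
- by move=> _ [u [k [u0 ->]]] Iu; apply: none; exists u, k.
have P1 : ~ P 1 by apply: SP; exists 1, 0; rewrite meval1 oner_neq0 expr0 mulr1.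
have [F [phi phiP]] := prime_ideal_kernel (ideal0 idP) (idealD idP) (idealM idP) P1 Pprime.
pose iota : {rmorphism K -> F} := phi \o @mpolyC n K.
pose xi i := phi 'X_i.
have xiE p : mmap iota xi p = phi p.
  have E := @mpoly_rmorph_ext n K F (mmap iota xi) phi.
  by apply: E => [c|i] /=; [rewrite mmapC|rewrite mmapX mmap1U].
have [|||x [xe xP gx]] := @specialization_near K F iota n xi g e.
- move=> p; rewrite xiE phiP => Pp; apply/eqP; apply: contrapT => /negP p0.
  by apply: SP Pp; exists p, 0; rewrite expr0 mulr1.
- rewrite xiE; apply/negP => /eqP/phiP; apply: SP.
  by exists 1, 1; rewrite meval1 oner_neq0 mul1r expr1.
- by [].
move/eqP: gx; apply; apply: gI => // p /IP Pp.
by apply: xP; rewrite xiE; apply/phiP.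
Qed.

(** * Initial exponents *)

Lemma meval_origin (A : comNzRingType) (n : nat) (p : {mpoly A[n]}) :
  p.@[fun=> 0] = p@_0%MM.
Proof.
rewrite {1 2}(mpolyE p) !raddf_sum /=; apply: eq_bigr => m _.
rewrite mevalZ mcoeffZ mevalX mcoeffX; congr (_ * _).
have [->|m0] := eqVneq m 0%MM; first by rewrite big1// => i _; rewrite mnm0E.
have [i mi] := mnm_neq0_gt0 m0.
by rewrite (bigD1 i)//= expr0n gtn_eqF// mul0r.
Qed.

Lemma is_ideal_sum (R : comNzRingType) (J : set R) (T : Type) (r : seq T)
    (Q : pred T) (F : T -> R) :
  is_ideal J -> (forall i, Q i -> J (F i)) -> J (\sum_(i <- r | Q i) F i).
Proof.
by move=> idJ JF; elim/big_ind: _ => //; [exact: ideal0|exact: idealD].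
Qed.

Lemma is_idealB (R : comNzRingType) (J : set R) x y :
  is_ideal J -> J x -> J y -> J (x - y).
Proof. by move=> idJ Jx Jy; rewrite -mulN1r; apply: idealD => //; apply: idealM. Qed.

Lemma ideal_gen_is_ideal (R : comNzRingType) (S : set R) : is_ideal (ideal_gen S).
Proof.
split.
- by exists 0, (fun=> 0), (fun=> 0); split => [[]//|[]//|]; rewrite big_ord0.
- move=> _ _ [m1 [c1 [s1 [_ S1 ->]]]] [m2 [c2 [s2 [_ S2 ->]]]].
  pose glue (f1 : 'I_m1 -> R) (f2 : 'I_m2 -> R) i :=
    match fintype.split i with inl j => f1 j | inr j => f2 j end.
  exists (m1 + m2)%N, (glue c1 c2), (glue s1 s2); split => // [i|].
    by rewrite /glue; case: fintype.split.
  rewrite big_split_ord /glue; congr (_ + _); apply: eq_bigr => i _.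
    by rewrite (unsplitK (inl i)).
  by rewrite (unsplitK (inr i)).
- move=> a _ [m [c [s [_ Ss ->]]]]; exists m, (fun i => a * c i), s; split => //.
  by rewrite mulr_sumr; apply: eq_bigr => i _; rewrite mulrA.
Qed.

Lemma ideal_gen_sub (R : comNzRingType) (S : set R) : S `<=` ideal_gen S.
Proof.
move=> s Ss; exists 1, (fun=> 1), (fun=> s); split => //.
by rewrite big_ord1 mul1r.
Qed.

Lemma is_largest_exists (n : nat) (ge : rel 'X_{1..n}) (s : seq 'X_{1..n}) :
  reflexive ge -> transitive ge -> total ge -> s != [::] -> exists a, is_largest ge s a.
Proof.
move=> ge_refl ge_trans ge_total; elim: s => // a s IHs _.
have [->|s0] := eqVneq s [::].
  by exists a; split; [rewrite inE|move=> b /[!inE] /eqP ->].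
have [b [bs bP]] := IHs s0; have [ab|ba] := orP (ge_total a b).
  exists a; split; first by rewrite inE eqxx.
  by move=> c /[!inE] /orP[/eqP ->//|/bP]; apply: ge_trans.
exists b; split; first by rewrite inE bs orbT.
by move=> c /[!inE] /orP[/eqP ->//|/bP].
Qed.

Section LocalOrder.
Variables (n : nat) (ge : rel 'X_{1..n}).
Hypothesis lmo : local_monomial_order ge.

(** Induction on the degree: removing one variable from a monomial makes it larger. *)
Lemma local_order_ge0 a : ge 0%MM a.
Proof.
have [k] := ubnP (mdeg a); elim: k a => // k IHk a ak.
have [->|a0] := eqVneq a 0%MM; first exact: lmo_refl.
have [i ai] := mnm_neq0_gt0 a0.
have aE : (U_(i) + (a - U_(i)) = a)%MM.
  by rewrite addmC submK//; apply/mnm_lepP => j; rewrite mnm1E; case: eqP => [<-|].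
have /andP[gi _] := lmo_local lmo i.
apply: (lmo_trans lmo (y := (a - U_(i))%MM)).
  by apply: IHk; move: ak; rewrite -aE mdegD mdeg1 add1n ltnS addmC addmK.
by have := lmo_add lmo (a - U_(i))%MM gi; rewrite add0m aE.
Qed.

Lemma local_order_addl a b : ge b (a + b)%MM.
Proof. by have := lmo_add lmo b (local_order_ge0 a); rewrite add0m. Qed.

Lemma local_order_addl_anti a b : ge (a + b)%MM b -> a = 0%MM.
Proof.
move=> h; have := lmo_anti lmo (introT andP (conj h (local_order_addl a b))).
by move/(congr1 (fun m => m - b)%MM); rewrite addmK => ->; apply/mnmP => i; rewrite mnmBE mnm0E subnn.
Qed.

End LocalOrder.

(** Stated on exponents, so that [initial_idealX] reduces the initial ideal to combinatorics; having
    a largest exponent forces [p] to be nonzero. *)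
Definition initial_exponent (K : numFieldType) (n : nat) (ge : rel 'X_{1..n})
    (I : set {mpoly K[n]}) (a : 'X_{1..n}) : Prop :=
  exists2 p, I p & is_largest ge (msupp p) a.

Section InitialIdeal.
Variables (K : numFieldType) (n : nat) (ge : rel 'X_{1..n}) (I : set {mpoly K[n]}).
Hypotheses (lmo : local_monomial_order ge) (idI : is_ideal I).

Lemma initial_exponent_addl a b : initial_exponent ge I a -> initial_exponent ge I (b + a)%MM.
Proof.
move=> [p Ip [ap aP]]; exists ('X_[b] * p); first exact: idealM.
have supp := msuppMX p b.
split; first by rewrite mulrC (perm_mem supp); apply/mapP; exists a.
move=> c; rewrite mulrC (perm_mem supp) => /mapP[d dp ->].
by rewrite addmC [(b + d)%MM]addmC; apply: (lmo_add lmo); apply: aP.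
Qed.

(** If [x^a] is a combination of initial monomials, it occurs in one of the terms and is thus
    divisible by an initial monomial. *)
Lemma initial_idealX a : initial_ideal ge I 'X_[a] <-> initial_exponent ge I a.
Proof.
split=> [|[p Ip ap]]; last first.
  apply: ideal_gen_sub; exists a => //; exists p; split => //.
  by apply/negP => /eqP p0; move: ap => []; rewrite p0 msupp0.
case=> m [c [s [_ sP E]]]; apply: contrapT => na.
have := congr1 (mcoeff a) E; rewrite mcoeffX eqxx raddf_sum /= big1 => [/eqP|i _].
  by rewrite oner_eq0.
have [b [p [Ip _ bp]] <-] := sP i; apply/eqP; rewrite mcoeff_eq0; apply/negP.
rewrite (perm_mem (msuppMX _ _)) => /mapP[d _ aE]; apply: na.
by rewrite aE addmC; apply: initial_exponent_addl; exists p.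
Qed.

(* Multiplying by a polynomial with nonzero constant term does not move the initial
   exponent, as 1 is the largest monomial. *)
Lemma initial_exponent_unit u p a : u.@[fun=> 0] != 0 -> I (u * p) ->
  is_largest ge (msupp p) a -> initial_exponent ge I a.
Proof.
rewrite meval_origin => u0 Iup [ap aP]; exists (u * p) => //; split.
  have uE : u * p = u@_0 *: p + (u - (u@_0)%:MP) * p.
    by rewrite mulrBl mul_mpolyC addrC subrK.
  rewrite mcoeff_msupp uE mcoeffD mcoeffZ; set r := (u - _) * p.
  suff -> : r@_a = 0 by rewrite addr0 mulf_neq0// -mcoeff_msupp.
  apply/eqP; rewrite mcoeff_eq0; apply/negP => /msuppM_le /allpairsP[[b c] /= [bu cp aE]].
  have b0 : b = 0%MM by apply: (local_order_addl_anti lmo (b := c)); rewrite -aE; apply: aP.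
  by move: bu; rewrite mcoeff_msupp b0 mcoeffB mcoeffC eqxx mulr1 subrr eqxx.
move=> b /msuppM_le /allpairsP[[c d] /= [_ dp ->]].
exact: (lmo_trans lmo) (aP _ dp) (local_order_addl lmo c d).
Qed.

End InitialIdeal.

(** * Normal forms *)

(* The contraction to R of the extension of I to the localization at the origin. *)
Definition saturation (K : numFieldType) (n : nat) (I : set {mpoly K[n]}) : set {mpoly K[n]} :=
  [set p | exists2 v, v.@[fun=> 0] != 0 & I (v * p)].

Section NormalForm.
Variables (K : numFieldType) (n : nat) (ge : rel 'X_{1..n}) (I : set {mpoly K[n]}) (k : nat).
Hypotheses (lmo : local_monomial_order ge) (idI : is_ideal I).
Hypothesis high_degree : forall a, (k <= mdeg a)%N -> saturation I 'X_[a].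

Local Notation J := (saturation I).
Local Notation E := (initial_exponent ge I).

Lemma saturation_is_ideal : is_ideal J.
Proof.
split.
- by exists 1; rewrite ?meval1 ?oner_neq0// mulr0; apply: ideal0.
- move=> x y [v v0 Ix] [w w0 Iy]; exists (v * w); first by rewrite mevalM mulf_neq0.
  rewrite mulrDr; apply: idealD => //.
    by rewrite -mulrA mulrCA; apply: idealM.
  by rewrite -mulrA; apply: idealM.
- by move=> a x [v v0 Ix]; exists v => //; rewrite mulrCA; apply: idealM.
Qed.

Lemma sub_saturation : I `<=` J.
Proof. by move=> p Ip; exists 1; rewrite ?meval1 ?oner_neq0// mul1r. Qed.

Lemma saturation_initial p a : J p -> is_largest ge (msupp p) a -> E a.
Proof. by move=> [v v0 Ip]; apply: initial_exponent_unit Ip. Qed.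

Lemma standard_low_degree a : ~ E a -> (mdeg a < k)%N.
Proof.
move=> na; rewrite ltnNge; apply/negP => /high_degree Ja; apply: na.
apply: (saturation_initial Ja); split; first by rewrite msuppX inE.
by move=> b; rewrite msuppX inE => /eqP ->; apply: (lmo_refl lmo).
Qed.

(** This is the uniqueness of normal forms: a nonzero [p] in [J] would have its largest exponent in
    [E]. *)
Lemma standard_saturation_eq0 p : J p -> (forall a, a \in msupp p -> ~ E a) -> p = 0.
Proof.
move=> Jp pE; apply/eqP; rewrite -msupp_eq0; apply: contraT => p0.
have [a ap] := is_largest_exists (lmo_refl lmo) (lmo_trans lmo) (lmo_total lmo) p0.
by case: (pE a); [case: ap|exact: saturation_initial ap].
Qed.

(** Reduction by an element of [I] with initial exponent [b] leaves strictly smaller monomials. A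
    local order allows infinite descent, but monomials of degree at least [k] reduce to 0. *)
Lemma normal_form_exists b : exists q, J ('X_[b] - q) /\
  forall a, a \in msupp q -> ~ E a /\ ge b a.
Proof.
(* The measure counts only exponents of degree below [k]. It drops from [b] to a strictly smaller
   [c], since [b] is counted for [b] and not for [c]. *)
pose below c := #|[pred d : 'X_{1..n < k} | ge c d]|.
have [N] := ubnP (below b); elim: N b => // N IHN b bN.
have [kb|bk] := leqP k (mdeg b).
  by exists 0; rewrite subr0; split; [exact: high_degree|move=> a; rewrite msupp0].
have [[p Ip [bp bmax]]|nEb] := pselect (E b); last first.
  exists 'X_[b]; rewrite subrr; split; first exact: (ideal0 saturation_is_ideal).
  by move=> a; rewrite msuppX inE => /eqP ->; split => //; apply: (lmo_refl lmo).
have pb : p@_b != 0 by rewrite -mcoeff_msupp.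
have /choice[q qP] : forall c, exists q, c \in msupp p -> c != b ->
    J ('X_[c] - q) /\ forall a, a \in msupp q -> ~ E a /\ ge b a.
  move=> c; have [cp|] := boolP (c \in msupp p); last by exists 0.
  have [->|cb] := eqVneq c b; first by exists 0.
  have [|q [Jq qP]] := IHN c.
    rewrite -ltnS (leq_trans _ bN)// ltnS; apply: proper_card; apply/properP; split.
      by apply/fintype.subsetP => d; rewrite !inE; apply: (lmo_trans lmo); apply: bmax.
    exists (BMultinom bk); rewrite !inE /=; first exact: (lmo_refl lmo).
    apply: contra cb => cb; apply/eqP/(lmo_anti lmo); rewrite cb; exact: bmax.
  exists q => _ _; split => // a /qP[nEa ca]; split => //.
  exact: (lmo_trans lmo) (bmax _ cp) ca.
(* Modulo [J], the relation [p] expresses [x^b] by its other monomials, each replaced by its own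
   normal form. *)
exists (\sum_(c <- msupp p | c != b) (- (p@_c / p@_b)) *: q c); split.
  have -> : 'X_[b] - \sum_(c <- msupp p | c != b) (- (p@_c / p@_b)) *: q c =
      (p@_b)^-1 *: p - \sum_(c <- msupp p | c != b) (p@_c / p@_b) *: ('X_[c] - q c).
    have -> : (p@_b)^-1 *: p = 'X_[b] + \sum_(c <- msupp p | c != b) (p@_c / p@_b) *: 'X_[c].
      rewrite {2}(mpolyE p) (bigD1_seq b) ?msupp_uniq//= scalerDr scalerA mulVf// scale1r.
      by rewrite scaler_sumr; congr (_ + _); apply: eq_bigr => c _; rewrite scalerA mulrC.
    rewrite -addrA -!sumrN -big_split /=; congr (_ + _); apply: eq_bigr => c _.
    by rewrite scalerBr opprB scaleNr opprK addrC subrK.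
  apply: (is_idealB saturation_is_ideal).
    by rewrite -mul_mpolyC; apply: (idealM saturation_is_ideal); exact: sub_saturation.
  rewrite big_seq_cond; apply: (is_ideal_sum _ saturation_is_ideal) => c /andP[cp cb].
  by rewrite -mul_mpolyC; apply: (idealM saturation_is_ideal); have [] := qP c cp cb.
move=> a; rewrite mcoeff_msupp raddf_sum /= => a0.
have [c /andP[cp cb] ac] : exists2 c, (c \in msupp p) && (c != b) & (q c)@_a != 0.
  apply: contrapT => none; move/eqP: a0; apply; rewrite big_seq_cond big1 // => c cpb.
  rewrite mcoeffZ; have [->|qa] := eqVneq (q c)@_a 0; first by rewrite mulr0.
  by exfalso; apply: none; exists c.
by have [_] := qP c cp cb; apply; rewrite mcoeff_msupp.
Qed.

End NormalForm.

(** * Dual functionals *)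

Lemma DeltaE (K : numFieldType) (n : nat) (a : 'X_{1..n}) (p : {mpoly K[n]}) :
  Delta a p = p@_a.
Proof.
rewrite /Delta meval_origin mcoeff_mderivm addm0 -[p@_a *+ _]mulr_natl mulrA.
have -> : (\prod_(i < n) (a i) ^_ (a i) = \prod_(i < n) (a i)`!)%N.
  by apply: eq_bigr => i _; rewrite ffactnn.
rewrite mulVf ?mul1r// pnatr_eq0 -lt0n prodn_gt0// => i; exact: fact_gt0.
Qed.

Lemma Delta_combE (K : numFieldType) (n : nat) (c : {fsfun 'X_{1..n} -> K with 0})
    (p : {mpoly K[n]}) : Delta_comb c p = \sum_(b <- msupp p) p@_b * c b.
Proof.
rewrite /Delta_comb.
under eq_bigr do rewrite DeltaE mulrC.
rewrite (bigID [pred b | b \in msupp p]) /= [X in _ + X]big1 ?addr0; last first.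
  by move=> b; rewrite mcoeff_msupp negbK => /eqP ->; rewrite mul0r.
rewrite [RHS](bigID [pred b | b \in finsupp c]) /= [X in _ = _ + X]big1 ?addr0; last first.
  by move=> b /fsfun_dflt ->; rewrite mulr0.
rewrite -big_filter -[RHS]big_filter; apply: perm_big.
apply: uniq_perm; rewrite ?filter_uniq ?msupp_uniq ?fset_uniq// => b.
by rewrite !mem_filter /= andbC.
Qed.

Lemma Delta_combX (K : numFieldType) (n : nat) (c : {fsfun 'X_{1..n} -> K with 0}) a :
  Delta_comb c 'X_[a] = c a.
Proof. by rewrite Delta_combE msuppX big_seq1 mcoeffX eqxx mul1r. Qed.

Lemma fsfun_of_low_degree (K : numFieldType) (n k : nat) (g : 'X_{1..n} -> K) :
  (forall b, (k <= mdeg b)%N -> g b = 0) ->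
  exists c : {fsfun 'X_{1..n} -> K with 0}, forall b, c b = g b.
Proof.
move=> gk; exists [fsfun b in [fset b in [seq bmnm m | m : 'X_{1..n < k}]]%fset => g b] => b.
rewrite fsfun_fun; case: ifPn => // bk; rewrite gk// leqNgt.
apply: contra bk => bk; rewrite in_fset.
by change (b \in [seq bmnm m | m : 'X_{1..n < k}]); apply/fintype.imageP; exists (BMultinom bk).
Qed.

Lemma fsfun_degree_bound (K : numFieldType) (n : nat) (c : {fsfun 'X_{1..n} -> K with 0}) :
  exists k, forall b, (k <= mdeg b)%N -> c b = 0.
Proof.
exists (\max_(b <- finsupp c) mdeg b).+1 => b; case: (finsuppP c b) => // bc.
by rewrite ltnNge (leq_bigmax_seq _ bc).
Qed.

Section Duality.
Variables (K : numFieldType) (n : nat) (ge : rel 'X_{1..n}) (I : set {mpoly K[n]}) (k : nat).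
Hypotheses (lmo : local_monomial_order ge) (idI : is_ideal I).
Hypothesis high_degree : forall a, (k <= mdeg a)%N -> saturation I 'X_[a].

Local Notation J := (saturation I).
Local Notation E := (initial_exponent ge I).
Local Notation D := (initial_support (opposite_order ge) I).

(** The support of [p] lies below [a] and that of the functional above [a], so only the term at [a]
    survives in its value at [p], and it is nonzero. *)
Lemma initial_support_standard a : D a -> ~ E a.
Proof.
move=> [c [[_ cI] _ [ac amin]]] [p Ip [ap amax]].
have := cI p Ip; rewrite Delta_combE (bigD1_seq a) ?msupp_uniq//= big_seq_cond big1.
  move/eqP; rewrite addr0 mulf_eq0 => /orP[]; apply/negP; first by rewrite -mcoeff_msupp.
  by rewrite -mem_finsupp.
move=> b /andP[bp ba]; case: (finsuppP c b) => [|bc]; first by rewrite mulr0.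
case/eqP: ba; apply: (lmo_anti lmo); rewrite amax// andbT; exact: amin.
Qed.

(** The normal form is extended linearly from monomials, and [cf a] reads off its coefficient at
    [a]. *)
Lemma normal_functional : exists (nf : {mpoly K[n]} -> {mpoly K[n]})
    (cf : 'X_{1..n} -> {fsfun 'X_{1..n} -> K with 0}),
  [/\ forall p, J (p - nf p), forall p a, a \in msupp (nf p) -> ~ E a,
      forall a p, Delta_comb (cf a) p = (nf p)@_a
    & forall a b, cf a b != 0 -> ge b a].
Proof.
have /choice[f fP] := normal_form_exists lmo idI high_degree.
have idJ := saturation_is_ideal idI.
(* Uniqueness makes the normal form vanish in high degree, so [cf a] has finite support. *)
have f_high b : (k <= mdeg b)%N -> f b = 0.
  move=> kb; have [Jf fE] := fP b.
  apply: (standard_saturation_eq0 (ge := ge) (I := I)) => // [|a /fE[]//].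
  rewrite -[f b](subrK 'X_[b]) -[f b - _]opprB addrC.
  exact: is_idealB (high_degree kb) Jf.
pose nf p := \sum_(b <- msupp p) p@_b *: f b.
have /choice[cf cfE] : forall a, exists c : {fsfun 'X_{1..n} -> K with 0},
    forall b, c b = (f b)@_a.
  by move=> a; apply: (@fsfun_of_low_degree _ _ k) => b /f_high ->; rewrite mcoeff0.
exists nf, cf; split.
- move=> p; rewrite {1}(mpolyE p) /nf -sumrB; apply: is_ideal_sum => // b _.
  by rewrite -scalerBr -mul_mpolyC; apply: idealM => //; case: (fP b).
- move=> p a; rewrite mcoeff_msupp raddf_sum /= => a0 Ea; move/eqP: a0; apply.
  rewrite big1// => b _; rewrite mcoeffZ.
  have [->|] := eqVneq (f b)@_a 0; first by rewrite mulr0.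
  by rewrite -mcoeff_msupp => /(proj2 (fP b))[].
- move=> a p; rewrite Delta_combE /nf raddf_sum; apply: eq_bigr => b _.
  by rewrite /= mcoeffZ cfE.
by move=> a b; rewrite cfE -mcoeff_msupp => /(proj2 (fP b))[].
Qed.

(** By uniqueness, normal forms fix standard monomials and vanish on [I]; the first gives the
    duality, the second the membership in the dual space. *)
Lemma normal_form_dual_basis : exists (nf : {mpoly K[n]} -> {mpoly K[n]})
    (cf : 'X_{1..n} -> {fsfun 'X_{1..n} -> K with 0}),
  [/\ forall p, J (p - nf p), forall p a, a \in msupp (nf p) -> ~ E a,
      forall a, dual_space I (Delta_comb (cf a)),
      forall a b, ~ E b -> cf a b = (b == a)%:R
    & forall a b, cf a b != 0 -> ge b a].
Proof.
have [nf [cf [Jnf nfE cfnf cfge]]] := normal_functional.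
have idJ := saturation_is_ideal idI.
have nf_standard p : (forall a, a \in msupp p -> ~ E a) -> nf p = p.
  move=> pE; apply/eqP; rewrite eq_sym -subr_eq0; apply/eqP.
  apply: (standard_saturation_eq0 (ge := ge) (I := I)) => // a /msuppB_le.
  by rewrite mem_cat => /orP[/pE|/nfE].
exists nf, cf; split => //.
- move=> a; split; first by exists (cf a).
  move=> p Ip; rewrite cfnf.
  suff -> : nf p = 0 by rewrite mcoeff0.
  apply: (standard_saturation_eq0 (ge := ge) (I := I)) => // [|b /nfE//].
  rewrite -[nf p](subrK p) -[nf p - p]opprB addrC.
  by apply: is_idealB => //; apply: sub_saturation.
- move=> a b nEb; rewrite -Delta_combX cfnf nf_standard ?mcoeffX// => c.
  by rewrite msuppX inE => /eqP ->.
Qed.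

(** Conversely, for a standard [a], the support of [cf a] contains [a] and lies above it, so [a] is
    its initial exponent for the opposite order. *)
Lemma initial_supportE a : D a <-> ~ E a.
Proof.
split; first exact: initial_support_standard.
move=> nEa; have [nf [cf [_ _ cfI cfX cfge]]] := normal_form_dual_basis.
have ca : cf a a != 0 by rewrite cfX// eqxx oner_neq0.
exists (cf a); split => //.
  move=> /(congr1 (fun L : {mpoly K[n]} -> K^o => L 'X_[a])).
  by rewrite /= Delta_combX; apply/eqP.
split; first by rewrite mem_finsupp.
by move=> b; rewrite mem_finsupp => /cfge.
Qed.

Lemma fct_sum_scale (d : nat) (x : 'I_d -> K) (L : 'I_d -> {mpoly K[n]} -> K^o) p :
  (\sum_(i < d) x i *: L i) p = \sum_(i < d) x i * L i p.
Proof. by rewrite fct_sumE; apply: eq_bigr. Qed.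

Variable s : seq 'X_{1..n}.
Hypotheses (us : uniq s) (sE : forall a, a \in s <-> ~ E a).

Let nth_standard (i : 'I_(size s)) : ~ E (nth 0%MM s i).
Proof. by apply/sE/mem_nth. Qed.

Let nth_eq (i j : 'I_(size s)) : (nth 0%MM s i == nth 0%MM s j) = (i == j).
Proof. by rewrite nth_uniq. Qed.

(* A functional of the dual space vanishing at all standard monomials has no initial
   exponent left. *)
Lemma dual_space_dim : has_dim (dual_space I) (size s).
Proof.
have [nf [cf [_ _ cfI cfX _]]] := normal_form_dual_basis.
exists (fun i => Delta_comb (cf (nth 0%MM s i))); split => [i|L [[c ->] cI]|x].
- exact: cfI.
(* The coordinates are the coefficients of [c] at the standard exponents; by duality the difference
   [c'] vanishes at all of these. *)
- pose x (i : 'I_(size s)) := c (nth 0%MM s i); exists x.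
  pose g b := c b - \sum_(i < size s) x i * cf (nth 0%MM s i) b.
  have [c' c'E] : exists c' : {fsfun 'X_{1..n} -> K with 0}, forall b, c' b = g b.
    have [k0 ck0] := fsfun_degree_bound c.
    have /choice[kk kkP] : forall i : 'I_(size s), exists k, forall b,
        (k <= mdeg b)%N -> cf (nth 0%MM s i) b = 0.
      by move=> i; exact: fsfun_degree_bound.
    apply: (@fsfun_of_low_degree _ _ (k0 + \sum_i kk i)) => b kb.
    rewrite /g ck0 ?(leq_trans (leq_addr _ _) kb)// big1 ?subr0// => i _.
    by rewrite kkP ?mulr0// (leq_trans _ kb)// (bigD1 i)//= addnCA leq_addr.
  have LE : Delta_comb c - \sum_(i < size s) x i *: Delta_comb (cf (nth 0%MM s i)) =
      Delta_comb c'.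
    apply/funext => p.
    transitivity (Delta_comb c p - (\sum_(i < size s) x i *: Delta_comb (cf (nth 0%MM s i))) p).
      by [].
    rewrite fct_sum_scale !Delta_combE.
    under [X in _ - X]eq_bigr do rewrite Delta_combE mulr_sumr.
    rewrite exchange_big -sumrB; apply: eq_bigr => b _; rewrite c'E /g mulrBr; congr (_ - _).
    by rewrite mulr_sumr; apply: eq_bigr => i _; rewrite mulrCA.
  rewrite /= LE; apply: contrapT => c'0.
  have c'I : dual_space I (Delta_comb c').
    split; first by exists c'.
    move=> p Ip; rewrite -LE.
    transitivity (Delta_comb c p - (\sum_(i < size s) x i *: Delta_comb (cf (nth 0%MM s i))) p).
      by [].
    rewrite cI// fct_sum_scale big1 ?subr0// => i _.
    by have [_ ->] := cfI (nth 0%MM s i); rewrite ?mulr0.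
  have c's : enum_fset (finsupp c') != [::].
    apply/eqP => c'nil; apply: c'0; apply/funext => p.
    by rewrite /Delta_comb c'nil big_nil.
  have [|||a ac'] := is_largest_exists (ge := opposite_order ge) _ _ _ c's.
  - exact: (lmo_refl lmo).
  - by move=> y z t zy yt; apply: (lmo_trans lmo) yt zy.
  - by move=> y z; exact: (lmo_total lmo).
  have Da : D a by exists c'.
  have /initial_supportE nEa := Da.
  have [ac'0 _] := ac'; move: ac'0; rewrite mem_finsupp c'E /g; apply/negP/negPn.
  have ja : (index a s < size s)%N by rewrite index_mem; apply/sE.
  have aE : nth 0%MM s (Ordinal ja) = a by rewrite nth_index//; apply/sE.
  rewrite (bigD1 (Ordinal ja)) //= big1 => [|i ij].
    by rewrite addr0 /x aE cfX// eqxx mulr1 subrr.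
  by rewrite cfX// -{1}aE nth_eq eq_sym (negPf ij) mulr0.
- move=> x0 j.
  have := congr1 (fun L : {mpoly K[n]} -> K^o => L 'X_[nth 0%MM s j]) x0.
  rewrite /= fct_sum_scale (bigD1 j)//= Delta_combX cfX// eqxx mulr1 big1 ?addr0//.
  by move=> i ij; rewrite Delta_combX cfX// nth_eq eq_sym (negPf ij) mulr0.
Qed.

End Duality.

(** * Multiplicity *)

Lemma mdeg_msupp_exp (A : comNzRingType) (n j : nat) (t : {mpoly A[n]}) a :
  t@_0%MM = 0 -> a \in msupp (t ^+ j) -> (j <= mdeg a)%N.
Proof.
move=> t0; elim: j a => // j IHj a; rewrite exprS => /msuppM_le /allpairsP[[b c] /= [bt ct ->]].
rewrite mdegD -add1n leq_add ?IHj// lt0n mdeg_eq0.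
by apply: contraTneq bt => ->; rewrite mcoeff_msupp t0 eqxx.
Qed.

Section Multiplicity.
Variables (K : numFieldType) (n : nat) (ge : rel 'X_{1..n}) (I : set {mpoly K[n]}) (k : nat).
Hypotheses (lmo : local_monomial_order ge) (idI : is_ideal I).
Hypothesis high_degree : forall a, (k <= mdeg a)%N -> saturation I 'X_[a].

Local Notation J := (saturation I).
Local Notation E := (initial_exponent ge I).

Lemma ratfun_of0 : ratfun_of 0 = 0 :> ratfun K n. Proof. exact: tofrac0. Qed.
Lemma ratfun_of1 : ratfun_of 1 = 1 :> ratfun K n. Proof. exact: tofrac1. Qed.
Lemma ratfun_ofD (p q : {mpoly K[n]}) : ratfun_of (p + q) = ratfun_of p + ratfun_of q.
Proof. exact: tofracD. Qed.
Lemma ratfun_ofB (p q : {mpoly K[n]}) : ratfun_of (p - q) = ratfun_of p - ratfun_of q.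
Proof. exact: tofracB. Qed.
Lemma ratfun_ofM (p q : {mpoly K[n]}) : ratfun_of (p * q) = ratfun_of p * ratfun_of q.
Proof. exact: tofracM. Qed.

Lemma ratfun_of_eq0 (p : {mpoly K[n]}) : (ratfun_of p == 0) = (p == 0).
Proof. exact: tofrac_eq0. Qed.

Lemma ratfun_of_neq0 (q : {mpoly K[n]}) : q.@[fun=> 0] != 0 -> ratfun_of q != 0.
Proof. by rewrite ratfun_of_eq0; apply: contraNneq => ->; rewrite meval0. Qed.

Lemma local_idealP (x : ratfun K n) : local_ideal I x <->
  exists h q, [/\ I h, q.@[fun=> 0] != 0 & x = ratfun_of h / ratfun_of q].
Proof.
split=> [[m [c [s [cL sI ->]]]]|[h [q [Ih q0 ->]]]]; last first.
  exists 1, (fun=> (ratfun_of q)^-1), (fun=> ratfun_of h); split => //.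
  - by move=> _; exists 1, q; rewrite ratfun_of1 mul1r.
  - by rewrite big_ord1 mulrC.
elim/big_ind: _ => [|y z [h [q [Ih q0 ->]]] [h' [q' [Ih' q'0 ->]]]|i _].
- by exists 0, 1; rewrite meval1 oner_neq0 ratfun_of0 mul0r; split => //; exact: ideal0.
- exists (h * q' + h' * q), (q * q'); split.
  + by apply: idealD => //; rewrite mulrC; apply: idealM.
  + by rewrite mevalM mulf_neq0.
  + rewrite ratfun_ofD !ratfun_ofM; apply: addf_div; exact: ratfun_of_neq0.
- have [p [q [q0 ->]]] := cL i; have [h Ih <-] := sI i.
  exists (p * h), q; split => //; first exact: idealM.
  by rewrite ratfun_ofM mulrAC.
Qed.

Lemma local_ideal_saturation (p q : {mpoly K[n]}) : q.@[fun=> 0] != 0 -> J p ->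
  local_ideal I (ratfun_of p / ratfun_of q).
Proof.
move=> q0 [v v0 Ivp]; apply/local_idealP; exists (v * p), (v * q).
by rewrite mevalM mulf_neq0// !ratfun_ofM -mulf_div divff ?mul1r//; exact: ratfun_of_neq0.
Qed.

Lemma saturation_local_ideal p : local_ideal I (ratfun_of p) -> J p.
Proof.
move=> /local_idealP[h [q [Ih q0 pE]]]; exists q => //.
suff -> : q * p = h by [].
apply/eqP; rewrite -subr_eq0 -ratfun_of_eq0 ratfun_ofB ratfun_ofM pE mulrC divfK ?subrr//.
exact: ratfun_of_neq0.
Qed.

Lemma local_idealD x y : local_ideal I x -> local_ideal I y -> local_ideal I (x + y).
Proof.
move=> /local_idealP[h [q [Ih q0 ->]]] /local_idealP[h' [q' [Ih' q'0 ->]]].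
apply/local_idealP; exists (h * q' + h' * q), (q * q'); split.
- by apply: idealD => //; rewrite mulrC; apply: idealM.
- by rewrite mevalM mulf_neq0.
- rewrite ratfun_ofD !ratfun_ofM; apply: addf_div; exact: ratfun_of_neq0.
Qed.

(* Modulo the maximal ideal to the power [k], the inverse of [q] is a truncated geometric series. *)
Lemma local_ring_mod_ideal (x : ratfun K n) : local_ring x ->
  exists p, local_ideal I (x - ratfun_of p).
Proof.
(* Here [q = c (1 - t)] with [t] free of constant term. The error is [p t^k / q], and [t^k] lies in
   [J] because its monomials have degree at least [k]. *)
move=> [p [q [q0 ->]]]; pose c := q.@[fun=> 0]; pose t := 1 - c^-1 *: q.
have t0 : t@_0%MM = 0.
  by rewrite mcoeffB mcoeffZ mcoeff1 eqxx -meval_origin mulVf ?subrr.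
pose r := c^-1 *: (p * \sum_(i < k) t ^+ i); exists r.
have Jt : J (t ^+ k).
  rewrite (mpolyE (t ^+ k)) big_seq; apply: (is_ideal_sum _ (saturation_is_ideal idI)) => a at_.
  rewrite -mul_mpolyC; apply: (idealM (saturation_is_ideal idI)).
  by apply: high_degree; apply: mdeg_msupp_exp at_.
have -> : ratfun_of p / ratfun_of q - ratfun_of r = ratfun_of (p * t ^+ k) / ratfun_of q.
  have qr0 := ratfun_of_neq0 q0.
  apply: (mulIf qr0); rewrite mulrBl !divfK// -ratfun_ofM -ratfun_ofB; congr ratfun_of.
  have -> : r * q = p * ((1 - t) * \sum_(i < k) t ^+ i).
    have -> : 1 - t = c^-1 *: q by rewrite /t opprB addrC subrK.
    rewrite /r -!scalerAl -scalerAr; congr (_ *: _).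
    by rewrite -mulrA; congr (_ * _); rewrite mulrC.
  have -> : (1 - t) * \sum_(i < k) t ^+ i = 1 - t ^+ k.
    by rewrite -opprB mulNr -subrX1 opprB.
  by rewrite mulrBr mulr1 opprB addrC subrK.
by apply: local_ideal_saturation => //; apply: (idealM (saturation_is_ideal idI)).
Qed.

Variable s : seq 'X_{1..n}.
Hypotheses (us : uniq s) (sE : forall a, a \in s <-> ~ E a).

Lemma ratfun_of_combination (x : 'I_(size s) -> K) :
  \sum_(i < size s) x i *: ratfun_of 'X_[nth 0%MM s i] =
  ratfun_of (\sum_(i < size s) x i *: 'X_[nth 0%MM s i]).
Proof.
rewrite (big_morph _ ratfun_ofD ratfun_of0); apply: eq_bigr => i _.
by rewrite -mul_mpolyC ratfun_ofM.
Qed.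

(** The classes of the standard monomials form a basis: they span by normal forms of polynomial
    representatives, and a combination of them lying in [J] is zero. *)
Lemma standard_multiplicity : multiplicity_at0 I (size s).
Proof.
have nthE (i : 'I_(size s)) : ~ E (nth 0%MM s i) by apply/sE/mem_nth.
have nth_eq (i j : 'I_(size s)) : (nth 0%MM s i == nth 0%MM s j) = (i == j).
  by rewrite nth_uniq.
have [nf [_ [Jnf nfE _ _ _]]] := normal_form_dual_basis lmo idI high_degree.
exists (fun i : 'I_(size s) => ratfun_of 'X_[nth 0%MM s i]); split.
- by move=> i; exists 'X_[nth 0%MM s i], 1; rewrite meval1 oner_neq0 ratfun_of1 divr1.
- move=> w /local_ring_mod_ideal[p wp]; exists (fun i => (nf p)@_(nth 0%MM s i)).
  rewrite ratfun_of_combination.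
  have -> : \sum_(i < size s) (nf p)@_(nth 0%MM s i) *: 'X_[nth 0%MM s i] = nf p.
    transitivity (\sum_(a <- s) (nf p)@_a *: 'X_[a]); first by rewrite (big_nth 0%MM) big_mkord.
    rewrite [RHS]mpolyE.
    rewrite (bigID [pred b | b \in msupp (nf p)]) /= [X in _ + X]big1 ?addr0; last first.
      by move=> b; rewrite mcoeff_msupp negbK => /eqP ->; rewrite scale0r.
    rewrite -big_filter; apply: perm_big.
    apply: uniq_perm; rewrite ?filter_uniq ?msupp_uniq// => b.
    by rewrite mem_filter /=; case: (boolP (b \in msupp _)) => //= /nfE/sE ->.
  rewrite -[w](subrK (ratfun_of p)) -addrA; apply: local_idealD => //.
  rewrite -ratfun_ofB -[ratfun_of _]divr1 -ratfun_of1.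
  by apply: local_ideal_saturation => //; rewrite meval1 oner_neq0.
- move=> x; rewrite ratfun_of_combination => /saturation_local_ideal Jx j.
  set p := \sum_(i < _) _ in Jx.
  have px i : p@_(nth 0%MM s (i : 'I_(size s))) = x i.
    rewrite raddf_sum (bigD1 i)//= mcoeffZ mcoeffX eqxx mulr1 big1 ?addr0// => l li.
    by rewrite mcoeffZ mcoeffX nth_eq (negPf li) mulr0.
  rewrite -px (standard_saturation_eq0 lmo Jx) ?mcoeff0// => a.
  rewrite mcoeff_msupp raddf_sum => a0 Ea; move/eqP: a0; apply.
  rewrite big1// => i _; rewrite /= mcoeffZ mcoeffX.
  by case: eqP => [ia|_]; [case: (nthE i); rewrite ia|rewrite mulr0].
Qed.

End Multiplicity.

(** * Isolated zeros and the conclusion *)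

(** Each coordinate vanishes at the only zero in the isolating ball, so the Nullstellensatz puts a
    power of it in the saturation; a monomial of high degree is divisible by one of these powers. *)
Lemma isolated_high_degree (K : numClosedFieldType) (n N : nat) (f : 'I_N -> {mpoly K[n]}) :
  isolated (zero_set f) 0 ->
  exists k, forall a, (k <= mdeg a)%N -> saturation (ideal_gen (range f)) 'X_[a].
Proof.
set I := ideal_gen _ => -[_ [V /nbhs_ballP[e /= e0 eV] VE]].
have idI : is_ideal I := ideal_gen_is_ideal _.
have vanish i : exists k, saturation I ('X_i ^+ k).
  have [|u [k [u0 Iu]]] := local_nullstellensatz (g := 'X_i) idI e0; last by exists k, u.
  move=> x xe xI; rewrite mevalXU.
  have : (V `&` zero_set f) (\row_j x j).
    split; first by apply: eV; split=> // j l; rewrite !mxE /ball /= sub0r normrN; apply: xe.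
    move=> j; rewrite -[RHS](xI (f j)); last by apply: ideal_gen_sub; exists j.
    by apply: meval_eq => l; rewrite mxE.
  by rewrite VE => /= /rowP/(_ i); rewrite !mxE.
have /choice[k kP] := vanish.
(* The successor covers [n = 0], where the monomial 1 has degree 0 and no index [i] exists. *)
exists (\sum_i k i).+1 => a ka.
have idJ := saturation_is_ideal idI.
have [i ki] : exists i, (k i <= a i)%N.
  apply/existsP; apply: contraLR ka; rewrite negb_exists -leqNgt => /forallP h.
  by rewrite mdegE leq_sum// => i _; move: (h i); rewrite -ltnNge => /ltnW.
have -> : 'X_[a] = 'X_[a - U_(i) *+ k i] * 'X_i ^+ k i :> {mpoly K[n]}.
  rewrite mpolyXn -mpolyXD submK//; apply/mnm_lepP => j.
  by rewrite mulmnE mnm1E; case: eqP => [<-|]; rewrite ?mul1n.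
exact: idealM.
Qed.

Theorem theorem3p4 (R : realType) (n N : nat) (f : 'I_N -> {mpoly R[i][n]})
    (ge : rel 'X_{1..n}) :
  isolated (zero_set f) 0 ->
  local_monomial_order ge ->
  let I := ideal_gen (range f) in
  let succeq := opposite_order ge in
  (exists d : nat,
     [/\ (initial_support succeq I #= `I_d)%card,
         has_dim (dual_space I) d
       & multiplicity_at0 I d]) /\
  standard_monomials ge I = [set 'X_[a] | a in initial_support succeq I].
Proof.
move=> f0 lmo I succeq; have idI : is_ideal I := ideal_gen_is_ideal _.
have [k Ik] := isolated_high_degree f0.
have suppE a : initial_support succeq I a <-> ~ initial_exponent ge I a.
  exact: initial_supportE Ik a.
split; last first.
  apply/seteqP; split=> [_ [[a ->] na]|_ [a Da <-]].
    by exists a => //; apply/suppE => Ea; apply: na; apply/initial_idealX.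
  split; first by exists a.
  by move=> Ia; have /suppE := Da; apply; apply/(initial_idealX lmo idI).
(* Standard exponents have degree below [k], so this finite enumeration contains them all. *)
pose s := [seq m <- [seq bmnm m | m : 'X_{1..n < k}] | `[< ~ initial_exponent ge I m >]].
have us : uniq s by rewrite filter_uniq// map_inj_uniq ?enum_uniq//; exact: val_inj.
have sE a : a \in s <-> ~ initial_exponent ge I a.
  rewrite mem_filter; split=> [/andP[/asboolP]//|nEa]; apply/andP; split; first exact/asboolP.
  have ak : (mdeg a < k)%N := standard_low_degree lmo Ik nEa.
  by apply/fintype.imageP; exists (BMultinom ak).
exists (size s); split.
- have -> : initial_support succeq I = [set` [fset a in s]%fset].
    by apply/seteqP; split=> a /=; rewrite !inE => h; [apply/sE/suppE|apply/suppE/sE].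
  by apply/card_eq_fsetP; rewrite card_fseq undup_id.
- exact: dual_space_dim lmo idI Ik _ us sE.
- exact: standard_multiplicity lmo idI Ik _ us sE.
Qed.
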